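(* Let $\gamma\ge1$ and let $T$ be an operator satisfying the $(\mathsf L^1(\gamma Q),\mathsf L^1(\gamma Q))$ convex body domination. Let $0\le b\in\mathrm{BMO}(\mathbb R^d)$ and let $\alpha,\beta\ge0$ with $\alpha+\beta\le1$. Then for every $p\in(1,\infty)$, $$\big\|b^\alpha T(b^\beta f)-b^\beta T(b^\alpha f)\big\|_{L^p(\mathbb R^d)}\lesssim_p\|b\|_{\mathrm{BMO}(\mathbb R^d)}^{\alpha+\beta}\|f\|_{L^p(\mathbb R^d)},$$ where the implied constant depends on $p$ (and on $T$ and the dimension $d$, but not on $b$ or $f$).
   Context: All functions are real-valued. $\mathsf L^1(Q)$ is $L^1(Q)$ with the normalised norm $\frac1{|Q|}\|\cdot\|_{L^1(Q)}$; $\gamma Q$ is the cube concentric with $Q$ with $\gamma$ times its side length. $\|b\|_{\mathrm{BMO}(\mathbb R^d)}=\sup_Q\frac1{|Q|}\int_Q|b-\langle b\rangle_Q|$ over all cubes $Q$, with $\langle b\rangle_Q=\frac1{|Q|}\int_Qb$. Convention $0^0=1$. For a normed space $X$ with closed dual unit ball $\bar B_{X^*}$ and $\vec x\in X^n$, $\langle\!\langle\vec x\rangle\!\rangle_X:=\{(\langle x_i,x^*\rangle)_{i=1}^n:x^*\in\bar B_{X^*}\}\subset\mathbb R^n$ (convex, compact, symmetric); for functions on $\mathbb R^d$ and $X$ a space of functions on a cube, restrictions to the cube are understood. For convex compact symmetric $A,B\subset\mathbb R^n$, $A\cdot B:=\{\vec a\cdot\vec b:\vec a\in A,\vec b\in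 B\}=[-r,r]$ is identified with $r\ge0$. A collection $\mathscr S$ of cubes is $\delta$-sparse ($\delta>0$) if there are pairwise disjoint measurable $E(Q)\subset Q$, $Q\in\mathscr S$, with $|E(Q)|\ge\delta|Q|$. Let $\mathscr D$ be a dyadic system of cubes in $\mathbb R^d$. Given normed spaces $X(Q),Y(Q)$ for each $Q\in\mathscr D$, a bilinear form $\tau:F\times G\to\mathbb R$ satisfies the $(X(Q),Y(Q))$ convex body domination if $F\subseteq X(Q)$, $G\subseteq Y(Q)$ for every $Q\in\mathscr D$ and, for every $n\in\mathbb N$, there are constants $C_n<\infty$, $\delta_n>0$ such that for every $(\vec f,\vec g)\in F^n\times G^n$ there is a $\delta_n$-sparse $\mathscr S\subset\mathscr D$ with $$|\tau(\vec f,\vec g)|\le C_n\sum_{Q\in\mathscr S}|Q|\,\langle\!\langle\vec f\rangle\!\rangle_{X(Q)}\cdot\langle\!\langle\vec g\rangle\!\rangle_{Y(Q)},\qquad \tau(\vec f,\vec g):=\sum_{i=1}^n\tau(f_i,g_i).$$ An operator $T:F\to G^*$ satisfies this if its form $\tau(f,g):=\langle Tf,g\rangle$ does. Here $F,G$ are function spaces on $\mathbb R^d$ containing $L^\infty_c(\mathbb R^d)$ (bounded compactly supported functions). The operator $f\mapsto b^\alpha T(b^\beta f)-b^\beta T(b^\alpha f)$ is defined through the form $(f,g)\mapsto\langle T(b^\beta f),b^\alpha g\rangle-\langle T(b^\alpha f),b^\beta g\rangle$ for $f\in F$ with $b^\alpha f,b^\beta f\in F$ and $g\in G$ with $b^\alpha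 g,b^\beta g\in G$; the asserted norm bound means that this form is bounded by (constant)$\cdot\|b\|_{\mathrm{BMO}}^{\alpha+\beta}\|f\|_{L^p}\|g\|_{L^{p'}}$ for all such $f\in L^p$, $g\in L^{p'}$ (dense subspaces). *)

(* Defs.v *)
From HB Require Import structures.
From mathcomp Require Import all_boot all_order all_algebra.
From mathcomp Require Import all_classical all_reals all_analysis.
Set Implicit Arguments.
Unset Strict Implicit.
Unset Printing Implicit Defensive.
Import Order.TTheory GRing.Theory Num.Theory.
Import numFieldNormedType.Exports.
Local Open Scope classical_set_scope.
Local Open Scope ring_scope.

(* Points of R^d, with the product Borel sigma-algebra. Classes of Lebesgue
   measurable functions are represented by Borel functions. *)
Notation euclid R d := (d.-tuple (measurableTypeR R)).

Section lebesgue_euclid.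
Context {R : realType}.
Local Notation RR := (measurableTypeR R).

Definition econs (n : nat) (z : RR * euclid R n) : euclid R n.+1 :=
  [tuple of z.1 :: z.2].

Lemma measurable_econs (n : nat) : measurable_fun [set: _] (@econs n).
Proof. exact: measurable_cons. Qed.

Section step.
Variables (n : nat) (m : {sigma_finite_measure set (euclid R n) -> \bar R}).

Definition lebesgue_step : set (euclid R n.+1) -> \bar R :=
  pushforward (@lebesgue_measure R \x m)%E (@econs n).

Let lebesgue_step0 : lebesgue_step set0 = 0%E.
Proof. by rewrite /lebesgue_step /pushforward preimage_set0 measure0. Qed.

Let lebesgue_step_ge0 A : (0 <= lebesgue_step A)%E.
Proof.
exact: (@measure_ge0 _ _ _
  (measure_function_pushforward__canonical__measure_function_Measure
    (@lebesgue_measure R \x m)%E (@measurable_econs n))).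
Qed.

Let lebesgue_step_sigma_additive : semi_sigma_additive lebesgue_step.
Proof.
exact: (@measure_semi_sigma_additive _ _ _
  (measure_function_pushforward__canonical__measure_function_Measure
    (@lebesgue_measure R \x m)%E (@measurable_econs n))).
Qed.

HB.instance Definition _ := isMeasure.Build _ _ _ lebesgue_step
  lebesgue_step0 lebesgue_step_ge0 lebesgue_step_sigma_additive.

Let lebesgue_step_sigma_finite : sigma_finite setT lebesgue_step.
Proof.
pose g (x : euclid R n.+1) : RR * euclid R n := (thead x, [tuple of behead x]).
have mg : measurable_fun setT g.
  apply/measurable_fun_pairP; split; first exact: measurable_tnth.
  exact: measurable_behead.
have gK : cancel (@econs n) g.
  by move=> [x t]; rewrite /g theadE; congr pair; apply/val_inj.
have /sigma_finiteP[F [FT ndF Foo]] := sigma_finiteT (@lebesgue_measure R).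
have /sigma_finiteP[G [GT ndG Goo]] := sigma_finiteT m.
exists (fun k => g @^-1` (F k `*` G k)).
  rewrite -preimage_bigcup (_ : \bigcup_k _ = setT) ?preimage_setT//.
  rewrite -setXTT FT GT predeqE => -[x y]; split.
    by move=> [k _ []/= ? ?]; split; exists k.
  move=> [/= [k _ Fx] [l _ Gy]]; exists (maxn k l) => //; split.
  - by move: x Fx; exact/subsetPset/ndF/leq_maxl.
  - by move: y Gy; exact/subsetPset/ndG/leq_maxr.
move=> k; have [mF Fk] := Foo k; have [mG Gk] := Goo k; split.
  by rewrite -[X in measurable X]setTI; apply: mg => //; exact: measurableX.
rewrite /lebesgue_step /pushforward -comp_preimage.
rewrite (_ : g \o _ = id) ?preimage_id; last by apply/funext => z /=; rewrite gK.
by rewrite product_measure1E// lte_mul_pinfty// ge0_fin_numE.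
Qed.

HB.instance Definition _ := Measure_isSigmaFinite.Build _ _ _ lebesgue_step
  lebesgue_step_sigma_finite.

End step.

Fixpoint lebesgue (n : nat) : {sigma_finite_measure set (euclid R n) -> \bar R} :=
  match n with
  | 0 => dirac ([tuple] : euclid R 0)
  | n'.+1 => lebesgue_step (lebesgue n')
  end.

End lebesgue_euclid.
Arguments lebesgue : clear implicits.

Lemma lebesgue_box (R : realType) (d : nat)
    (A : 'I_d -> set (measurableTypeR R)) :
  (forall i, measurable (A i)) ->
  lebesgue R d [set x | forall i, A i (tnth x i)] =
  \big[*%E/1%E]_(i < d) lebesgue_measure (A i).
Proof.
elim: d A => [|d IH] A mA.
  by rewrite big_ord0 /= diracE mem_set//= => -[].
rewrite big_ord_recl -(IH (fun i => A (lift ord0 i)))//=.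
rewrite /lebesgue_step /pushforward -product_measure1E//=; last first.
  rewrite (_ : [set _ | _] = \bigcap_(i in [set: 'I_d])
      [set x : euclid R d | A (lift ord0 i) (tnth x i)]); last first.
    by by apply/seteqP; split=> x /= Ax i => [_|]; exact: Ax.
  apply: fin_bigcap_measurable; first exact: finite_finset.
  by move=> i _; rewrite -[X in measurable X]setTI; apply: measurable_tnth.
congr (product_measure1 _ _ _); apply/seteqP; split=> -[x y] /=.
- move=> Axy; split; first by have := Axy ord0; rewrite (tnth_nth x).
  by move=> i; have := Axy (lift ord0 i); rewrite !(tnth_nth x).
- move=> [Ax Ay] i; case: (unliftP ord0 i) => [j ->|->].
    by have := Ay j; rewrite !(tnth_nth x).
  by rewrite (tnth_nth x).
Qed.

Section cubes.
Context {R : realType} {d : nat}.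

(* A cube is a pair (center, side length); only positive sides are used. The
   pair, unlike the half-open set cube_set, makes concentric dilation direct. *)
Definition cube : Type := (euclid R d * R)%type.
Definition center (Q : cube) : euclid R d := Q.1.
Definition side (Q : cube) : R := Q.2.
HB.instance Definition _ := Choice.on cube.

Definition cube_set (Q : cube) : set (euclid R d) :=
  [set x | forall i, tnth (center Q) i - side Q / 2 <= tnth x i
                     < tnth (center Q) i + side Q / 2].

Definition dilate (gamma : R) (Q : cube) : cube := (center Q, gamma * side Q).

Definition vol (Q : cube) : R := fine (lebesgue R d (cube_set Q)).

Definition generation (D : set cube) (k : int) : set cube :=
  [set Q | D Q /\ side Q = 2 ^ (- k)].

Definition dyadic_system (D : set cube) : Prop :=
  [/\ forall Q, D Q -> exists k, generation D k Q,
      forall k, partition (generation D k) cube_set setT &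
      forall k Q, generation D (k + 1) Q ->
        exists2 P, generation D k P & cube_set Q `<=` cube_set P].

Definition sparse (delta : R) (S : set cube) : Prop :=
  exists E : cube -> set (euclid R d),
    [/\ forall Q, S Q -> measurable (E Q),
        forall Q, S Q -> E Q `<=` cube_set Q,
        trivIset S E &
        forall Q, S Q -> ((delta * vol Q)%:E <= lebesgue R d (E Q))%E].

Definition average (Q : cube) (f : euclid R d -> R) : R :=
  (vol Q)^-1 * \int[lebesgue R d]_(x in cube_set Q) f x.

Definition bmo_norm (b : euclid R d -> R) : \bar R :=
  ereal_sup [set (average Q (fun x => `|b x - average Q b|))%:E |
             Q in [set Q : cube | 0 < side Q]].

Definition BMO : set (euclid R d -> R) :=
  [set b | (forall Q : cube,
              (lebesgue R d).-integrable (cube_set Q) (EFin \o b)) /\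
           (bmo_norm b < +oo)%E].

End cubes.
Arguments cube : clear implicits.

Section convex_bodies.
Context {R : realType} {d : nat}.
Local Notation func := (euclid R d -> R).

Definition linear_on (F : set func) (phi : func -> R) : Prop :=
  forall (a : R) (u v : func), F u -> F v ->
    phi (a *: u + v) = a * phi u + phi v.

(* A normed space of (classes of) functions, given by its representatives. No
   quotient is taken: the functionals in dual_ball below vanish on the
   functions of norm zero. *)
Record fspace := FSpace {
  carrier : set func;
  fnorm : func -> R }.

Definition dual_ball (X : fspace) : set (func -> R) :=
  [set phi | linear_on (carrier X) phi /\
             forall u, carrier X u -> `|phi u| <= fnorm X u].

Definition convex_body (X : fspace) (n : nat) (f : 'I_n -> func) :
    set 'rV[R]_n :=
  [set \row_i phi (f i) | phi in dual_ball X].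

(* The r such that A . B = [-r, r], for A and B convex, compact, symmetric. *)
Definition body_dot (n : nat) (A B : set 'rV[R]_n) : \bar R :=
  ereal_sup [set (\sum_i a 0 i * b 0 i)%:E | a in A & b in B].

Definition L1_normalized (Q : cube R d) : fspace := {|
  carrier := [set f | (lebesgue R d).-integrable (cube_set Q) (EFin \o f)];
  fnorm := fun f => average Q (fun x => `|f x|) |}.

(* Compact support in R^d is support in a bounded set. *)
Definition Linfc : set func :=
  [set f : func | measurable_fun setT f /\
    exists M : R, forall x, `|f x| <= M /\
      (f x != 0 -> forall i, `|tnth x i| <= M)].

Definition function_space (F : set func) : Prop :=
  GRing.submod_closed (mem F) /\ Linfc `<=` F.

(* T is a linear operator from F to the dual of G; T f g stands for <T f, g> *)
Definition operator_to_dual (F G : set func) (T : func -> func -> R) : Prop :=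
  (forall f, F f -> linear_on G (T f)) /\
  (forall g, G g -> linear_on F (T ^~ g)).

Definition convex_body_domination (D : set (cube R d))
    (X Y : cube R d -> fspace) (F G : set func) (tau : func -> func -> R) :
    Prop :=
  (forall Q, D Q -> F `<=` carrier (X Q) /\ G `<=` carrier (Y Q)) /\
  forall n : nat, exists C delta : R, [/\ 0 < C, 0 < delta &
    forall f g : 'I_n -> func, (forall i, F (f i)) -> (forall i, G (g i)) ->
    exists S : set (cube R d), [/\ S `<=` D, sparse delta S &
      (`|\sum_i tau (f i) (g i)|%:E <=
       C%:E * \esum_(Q in S) ((vol Q)%:E *
                body_dot (convex_body (X Q) f) (convex_body (Y Q) g)))%E]].

(* powR satisfies 0 `^ 0 = 1. *)
Definition powmul (b : func) (s : R) (f : func) : func :=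
  fun x => b x `^ s * f x.

End convex_bodies.

(* Main.v *)
(* With f = (b^beta f, b^alpha f) and g = (b^alpha g, - b^beta g), the convex body
   domination bounds the form by a sparse sum. For functionals phi, psi of norm at
   most 1 on the normalised L^1 of a cube, linearity alone (without representing
   them by functions) bounds each term of the sum by the average over x and y of
   |f(x)| |g(y)| |b(x)^beta b(y)^alpha - b(x)^alpha b(y)^beta|, and the kernel is at
   most |b(x) - b(y)|^s <= |b(x) - c|^s + |b(y) - c|^s, where s = alpha + beta <= 1
   and c is the mean of b. By the John-Nirenberg inequality the factor |b - c|^s
   costs only ||b||_BMO^s and the passage from L^1 to L^r averages, for some r > 1
   smaller than p and p'. The remaining sparse sum of L^r averages is bounded by
   the Carleson embedding theorem, a consequence of the weak type (1,1) inequality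
   for a finite family of cubes.

   In the John-Nirenberg inequality, Lebesgue differentiation is replaced by the
   fact that a measurable set is, up to a small error, a union of dyadic subcubes
   of a fine enough generation. *)
Require Import Defs.
From mathcomp Require Import all_boot all_order all_algebra finmap.
From mathcomp Require Import all_classical all_reals all_analysis.
From mathcomp Require Import measurable_realfun lra.
Set Implicit Arguments.
Unset Strict Implicit.
Unset Printing Implicit Defensive.
Import Order.TTheory GRing.Theory Num.Theory.
Import numFieldNormedType.Exports.
Local Open Scope classical_set_scope.
Local Open Scope ring_scope.

(** The constant must not depend on alpha and beta. This is achieved by z^s <= max(1, z), which
    compares |b - c|^s with an exponential weight at a cost free of s. The lower bound on |E(Q)| is
    used as |Q| <= delta^-1 |E(Q)|. Since E(Q) also lies in gamma Q, the embedding is run with the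
    cubes gamma Q and the sets E(Q), so the dilation costs nothing. The estimates divide by the
    norms of b, f and g. They are therefore proved for arbitrary positive majorants B, X, Y of these
    norms, and the majorants are lowered to the norms at the very end. *)

Local Notation center := Defs.center.

(** * Cubes and their children *)

Section cube_geometry.
Context {R : realType} {d : nat}.
Local Notation mu := (lebesgue R d).
Implicit Types (Q P : cube R d) (A E : set (euclid R d)).

Lemma measurable_coordinate (i : 'I_d) (A : set (measurableTypeR R)) :
  measurable A -> measurable [set x : euclid R d | A (tnth x i)].
Proof.
by move=> mA; rewrite -[X in measurable X]setTI; exact: measurable_tnth.
Qed.

Lemma cube_set_box Q : cube_set Q = [set x | forall i,
  `[tnth (center Q) i - side Q / 2, tnth (center Q) i + side Q / 2[%classic
    (tnth x i)].
Proof. by apply/seteqP; split=> x /= h i; have := h i; rewrite /= in_itv. Qed.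

Lemma measurable_cube Q : measurable (cube_set Q).
Proof.
rewrite cube_set_box (_ : [set _ | _] = \bigcap_(i in [set: 'I_d])
    [set x : euclid R d | `[tnth (center Q) i - side Q / 2,
       tnth (center Q) i + side Q / 2[%classic (tnth x i)]); last first.
  by apply/seteqP; split=> x /= Ax i => [_|]; exact: Ax.
apply: fin_bigcap_measurable; first exact: finite_finset.
by move=> i _; exact: measurable_coordinate.
Qed.

Lemma lebesgue_cube Q : 0 <= side Q -> mu (cube_set Q) = (side Q ^+ d)%:E.
Proof.
move=> l0; rewrite cube_set_box (@lebesgue_box R d
    (fun i => `[tnth (center Q) i - side Q / 2, tnth (center Q) i + side Q / 2[%classic))//.
rewrite (eq_bigr (fun=> (side Q)%:E)) => [|i _].
  by rewrite prodEFin prodr_const card_ord.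
rewrite lebesgue_measure_itv/= lte_fin; case: ifPn => h.
  by rewrite -EFinB; congr EFin; lra.
by congr EFin; lra.
Qed.

Lemma volE Q : 0 <= side Q -> vol Q = side Q ^+ d.
Proof. by move=> l0; rewrite /vol lebesgue_cube. Qed.

Lemma vol_gt0 Q : 0 < side Q -> 0 < vol Q.
Proof. by move=> l0; rewrite volE ?exprn_gt0// ltW. Qed.

Lemma lebesgue_cubeE Q : 0 <= side Q -> mu (cube_set Q) = (vol Q)%:E.
Proof. by move=> l0; rewrite lebesgue_cube// volE. Qed.

Lemma lebesgue_cube_lty Q : 0 <= side Q -> (mu (cube_set Q) < +oo)%E.
Proof. by move=> l0; rewrite lebesgue_cube// ltry. Qed.

Definition child Q (e : {ffun 'I_d -> bool}) : cube R d :=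
  ([tuple tnth (center Q) i + (if e i then 1 else -1) * (side Q / 4) | i < d],
   side Q / 2).

Lemma side_child Q e : side (child Q e) = side Q / 2.
Proof. by []. Qed.

Lemma cube_set_child Q e x : cube_set (child Q e) x <-> forall i,
  if e i then tnth (center Q) i <= tnth x i < tnth (center Q) i + side Q / 2
  else tnth (center Q) i - side Q / 2 <= tnth x i < tnth (center Q) i.
Proof.
split=> h i; have := h i; rewrite /center/= ?tnth_mktuple /side/=.
  by case: (e i) => /andP[h1 h2]; apply/andP; split; move: h1 h2; rewrite /side; lra.
by case: (e i) => /andP[h1 h2]; apply/andP; split; move: h1 h2; rewrite /side; lra.
Qed.

Lemma cube_children Q : 0 < side Q ->
  cube_set Q = \big[setU/set0]_(e : {ffun 'I_d -> bool}) cube_set (child Q e).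
Proof.
move=> l0; rewrite -bigcup_seq; apply/seteqP; split=> x /=.
  move=> Qx; exists [ffun i => tnth (center Q) i <= tnth x i].
    by rewrite /= mem_index_enum.
  apply/cube_set_child => i; rewrite ffunE; have /andP[h1 h2] := Qx i.
  by case: (leP (tnth (center Q) i)) => h; apply/andP; split.
move=> [e _ /cube_set_child Qx] i; have := Qx i.
by case: (e i) => /andP[h1 h2]; apply/andP; split; lra.
Qed.

Lemma trivIset_children Q (I : set {ffun 'I_d -> bool}) :
  trivIset I (fun e => cube_set (child Q e)).
Proof.
move=> e e' _ _ [x [/cube_set_child h /cube_set_child h']].
apply/ffunP => i; have := h i; have := h' i.
by case: (e i) (e' i) => -[]// /andP[? ?] /andP[? ?]; lra.
Qed.

Lemma ge0_integral_children Q (h : euclid R d -> R) : 0 < side Q ->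
  measurable_fun (cube_set Q) h -> (forall x, 0 <= h x) ->
  (\int[mu]_(x in cube_set Q) (h x)%:E =
   \sum_(e : {ffun 'I_d -> bool}) \int[mu]_(x in cube_set (child Q e)) (h x)%:E)%E.
Proof.
move=> l0 mh h0; rewrite [in LHS](cube_children l0) ge0_integral_bigsetU//.
- by move=> e; exact: measurable_cube.
- exact: index_enum_uniq.
- exact: trivIset_children.
- by rewrite -cube_children//; exact/measurable_EFinP.
- by move=> x _; rewrite lee_fin.
Qed.

Lemma measure_children Q E : 0 < side Q -> measurable E ->
  mu (E `&` cube_set Q) =
  (\sum_(e : {ffun 'I_d -> bool}) mu (E `&` cube_set (child Q e)))%E.
Proof.
move=> l0 mE; rewrite -integral_indic//; last exact: measurable_cube.
rewrite ge0_integral_children//.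
by apply: eq_bigr => e _; rewrite integral_indic//; exact: measurable_cube.
Qed.

Lemma child_sub Q e : 0 < side Q -> cube_set (child Q e) `<=` cube_set Q.
Proof.
move=> l0 x /cube_set_child Qx i; have := Qx i.
by case: (e i) => /andP[h1 h2]; apply/andP; split; lra.
Qed.

Lemma side_child_gt0 Q e : 0 < side Q -> 0 < side (child Q e).
Proof. by move=> l0; rewrite side_child divr_gt0. Qed.

Lemma vol_child Q e : 0 < side Q -> vol Q = 2 ^+ d * vol (child Q e).
Proof.
move=> l0; rewrite !volE ?side_child ?divr_ge0 ?ltW//.
by rewrite expr_div_n mulrC divfK// expf_neq0.
Qed.

Lemma vol_dilate c Q : 0 <= c -> 0 <= side Q ->
  vol (dilate c Q) = c ^+ d * vol Q.
Proof. by move=> c0 l0; rewrite !volE ?mulr_ge0// exprMn. Qed.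

Lemma cube_set_dilate c Q : 1 <= c -> 0 < side Q ->
  cube_set Q `<=` cube_set (dilate c Q).
Proof.
move=> c1 l0 x Qx i; have /andP[h1 h2] := Qx i.
have : side Q <= c * side Q by rewrite ler_peMl// ltW.
by rewrite /dilate/side/center/= -!/(side _) => ?; apply/andP; split; lra.
Qed.

(** In each coordinate a point of Q is within [side Q] of the common point, which is within
    [side P / 2] of the center of P: together at most 3/2 of [side P]. *)
Lemma cube_set_meet P Q : 0 < side P -> side Q <= side P ->
  cube_set P `&` cube_set Q !=set0 -> cube_set Q `<=` cube_set (dilate 3 P).
Proof.
move=> l0 lQP [y [Py Qy]] x Qx i.
have /andP[h1 h2] := Py i; have /andP[h3 h4] := Qy i; have /andP[h5 h6] := Qx i.
by rewrite /dilate/side/center/= -!/(side _) -!/(center _);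
  apply/andP; split; lra.
Qed.

End cube_geometry.

(** * Dyadic approximation of measurable sets *)

Section straddling_cells.
Context {R : realType} {d : nat}.
Local Notation mu := (lebesgue R d).
Implicit Types (Q P : cube R d) (A E F : set (euclid R d)).

(* The smaller of the parts of a subcube inside and outside [E], summed over the
   subcubes of generation [n]: it is small when [E] is nearly a union of them. *)
Fixpoint straddle (n : nat) E Q : \bar R :=
  match n with
  | 0 => Order.min (mu (E `&` cube_set Q)) (mu (~` E `&` cube_set Q))
  | n'.+1 => (\sum_(e : {ffun 'I_d -> bool}) straddle n' E (child Q e))%E
  end.

Let mI E Q : measurable E -> measurable (E `&` cube_set Q).
Proof. by move=> mE; apply: measurableI => //; exact: measurable_cube. Qed.

Let mCI E Q : measurable E -> measurable (~` E `&` cube_set Q).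
Proof. by move=> mE; apply: mI; exact: measurableC. Qed.

Let le_mu E F : measurable E -> measurable F -> E `<=` F -> (mu E <= mu F)%E.
Proof. by move=> mE mF EF; rewrite le_measure ?inE. Qed.

Lemma straddle_ge0 n E Q : (0 <= straddle n E Q)%E.
Proof.
elim: n Q => [Q|n IH Q] /=; last by apply: sume_ge0 => e _; exact: IH.
by rewrite le_min !measure_ge0.
Qed.

Lemma straddleC n E Q : straddle n (~` E) Q = straddle n E Q.
Proof.
elim: n Q => [Q|n IH Q] /=; last by apply: eq_bigr => e _; exact: IH.
by rewrite setCK minC.
Qed.

(** In a single cube, if one of the two minima is an outside part, the outside part of the union is
    smaller still; otherwise both are inside parts, and these are subadditive. *)
Lemma straddleU n E F Q : measurable E -> measurable F ->
  (straddle n (E `|` F) Q <= straddle n E Q + straddle n F Q)%E.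
Proof.
move=> mE mF; elim: n Q => [Q|n IH Q] /=; last first.
  by rewrite -big_split/=; apply: lee_sum => e _; exact: IH.
have mEF := measurableU _ _ mE mF.
have h1 : (mu ((E `|` F) `&` cube_set Q) <=
    mu (E `&` cube_set Q) + mu (F `&` cube_set Q))%E.
  by rewrite setIUl; apply: measureU2; exact: mI.
have h2 : (mu (~` (E `|` F) `&` cube_set Q) <= mu (~` E `&` cube_set Q))%E.
  by apply: le_mu; [exact: mCI|exact: mCI|move=> x []; rewrite setCU => -[]].
have h3 : (mu (~` (E `|` F) `&` cube_set Q) <= mu (~` F `&` cube_set Q))%E.
  by apply: le_mu; [exact: mCI|exact: mCI|move=> x []; rewrite setCU => -[]].
rewrite ge_min; case: (leP (mu (~` E `&` _)) (mu (E `&` _))) => _.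
  rewrite orbC (le_trans h2)// leeDl// le_min !measure_ge0//.
case: (leP (mu (~` F `&` _)) (mu (F `&` _))) => _; last by rewrite h1.
by rewrite orbC (le_trans h3)// leeDr.
Qed.

(** [straddle] is not monotone in the set; this substitute lets a countable union be replaced by a
    finite one at the cost of the measure of the remainder. *)
Lemma straddle_sub n E F Q : 0 < side Q -> measurable E -> measurable F ->
  F `<=` E -> (straddle n E Q <= straddle n F Q + mu ((E `\` F) `&` cube_set Q))%E.
Proof.
move=> l0 mE mF FE; have mD := measurableD mE mF.
elim: n Q l0 => [Q l0|n IH Q l0] /=; last first.
  rewrite (measure_children l0 mD) -big_split/=; apply: lee_sum => e _.
  exact/IH/side_child_gt0.
have h1 : (mu (E `&` cube_set Q) <=
    mu (F `&` cube_set Q) + mu ((E `\` F) `&` cube_set Q))%E.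
  by rewrite -{1}(setDUK FE) setIUl; apply: measureU2; exact: mI.
have h2 : (mu (~` E `&` cube_set Q) <= mu (~` F `&` cube_set Q))%E.
  by apply: le_mu; [exact: mCI|exact: mCI|apply: setSI; exact: subsetC].
rewrite ge_min; case: (leP (mu (F `&` _)) (mu (~` F `&` _))) => _.
  by rewrite h1.
by rewrite orbC (le_trans h2)// leeDl.
Qed.

Let strip (i : 'I_d) (a h : R) : set (euclid R d) :=
  [set x | `[a - h, a + h]%classic (tnth x i)].

Let measurable_strip i a h : measurable (strip i a h).
Proof. exact: measurable_coordinate. Qed.

Let halfspace (i : 'I_d) (a : R) : set (euclid R d) :=
  [set x | `]-oo, a[%classic (tnth x i)].

Let measurable_halfspace i a : measurable (halfspace i a).
Proof. exact: measurable_coordinate. Qed.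

(** Only subcubes crossing the hyperplane contribute, and a crossing cube lies within its own side
    length of the hyperplane. *)
Lemma straddle_halfspace n i a Q : 0 < side Q ->
  (straddle n (halfspace i a) Q <=
   mu (strip i a (side Q / 2 ^+ n) `&` cube_set Q))%E.
Proof.
move=> l0; elim: n Q l0 => [Q l0|n IH Q l0] /=; last first.
  rewrite (measure_children l0 (measurable_strip _ _ _)); apply: lee_sum => e _.
  rewrite (le_trans (IH _ (side_child_gt0 e l0)))// side_child exprS.
  by rewrite invfM mulrA.
rewrite expr0 divr1 ge_min.
have [h|h] := leP (tnth (center Q) i + side Q / 2) a.
  rewrite orbC (_ : ~` _ `&` _ = set0) ?measure0 ?measure_ge0//.
  apply/seteqP; split=> // x []; rewrite /halfspace/= in_itv/= => h1 Qx.
  have /andP[h2 h3] := Qx i; apply: h1; lra.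
have [k|k] := leP a (tnth (center Q) i - side Q / 2).
  rewrite (_ : halfspace i a `&` _ = set0) ?measure0 ?measure_ge0//.
  apply/seteqP; split=> // x []; rewrite /halfspace/= in_itv/= => h1 Qx.
  have /andP[h2 h3] := Qx i; lra.
apply/orP; left; apply: le_mu.
- exact: mI.
- exact: mI.
- move=> x []; rewrite /halfspace/= in_itv/= => h1 Qx; split => //.
  by rewrite /strip/= in_itv/=; have /andP[h2 h3] := Qx i; apply/andP; split; lra.
Qed.

Lemma lebesgue_strip i a Q : 0 < side Q -> exists2 K : R, 0 <= K &
  forall h, 0 <= h -> (mu (strip i a h `&` cube_set Q) <= (2 * h * K)%:E)%E.
Proof.
move=> l0; exists (\prod_(j < d | j != i) side Q).
  by apply: prodr_ge0 => j _; exact: ltW.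
move=> h h0.
pose A j : set (measurableTypeR R) := if j == i then `[a - h, a + h]%classic else
  `[tnth (center Q) j - side Q / 2, tnth (center Q) j + side Q / 2[%classic.
have mA j : measurable (A j) by rewrite /A; case: ifP.
apply: (@le_trans _ _ (mu [set x | forall j, A j (tnth x j)])).
  apply: le_mu; first exact: mI.
    rewrite (_ : [set _ | _] = \bigcap_(j in [set: 'I_d])
      [set x : euclid R d | A j (tnth x j)]); last first.
    by apply/seteqP; split=> x /= Ax j => [_|]; exact: Ax.
  - apply: fin_bigcap_measurable; first exact: finite_finset.
    by move=> j _; exact: measurable_coordinate.
  - move=> x [sx Qx] j; rewrite /A; case: eqP => [->//|_].
    by move: Qx; rewrite cube_set_box => /(_ j).
rewrite lebesgue_box// (bigD1 i)//= {1}/A eqxx lebesgue_measure_itv/= lte_fin.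
rewrite (eq_bigr (fun=> (side Q)%:E)) => [|j ji].
  rewrite prodEFin EFinM; apply: lee_wpmul2r.
    by rewrite lee_fin; apply: prodr_ge0 => j _; exact: ltW.
  case: ifPn => _; last by rewrite lee_fin mulr_ge0.
  by rewrite -EFinB lee_fin; lra.
rewrite /A (negbTE ji) lebesgue_measure_itv/= lte_fin; case: ifPn => k.
  by rewrite -EFinB; congr EFin; lra.
by congr EFin; lra.
Qed.

(** The bound is asked for all large [n], not for a single one, so that two sets can be approximated
    in a common generation. *)
Let vanishing Q E := measurable E /\ forall eps : R, 0 < eps ->
  exists N, forall n, (N <= n)%N -> (straddle n E Q <= eps%:E)%E.

Let vanishing_halfspace Q i a : 0 < side Q -> vanishing Q (halfspace i a).
Proof.
move=> l0; split => // eps e0; have [K K0 hK] := lebesgue_strip i a l0.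
pose N := (Num.truncn (2 * side Q * K / eps)).+1; exists N => n Nn.
apply: (le_trans (straddle_halfspace _ _ _ l0)).
apply: (le_trans (hK _ _)); first by rewrite divr_ge0// ?exprn_ge0// ltW.
rewrite lee_fin.
have h1 : 2 * side Q * K / eps <= 2 ^+ n.
  apply: (@le_trans _ _ N%:R).
    by rewrite ltW// truncnS_gt// !mulr_ge0// ?invr_ge0 ltW.
  rewrite -natrX ler_nat (leq_trans Nn)// ltnW// ltn_expl//.
have n0 : 0 < (2 : R) ^+ n by rewrite exprn_gt0.
have -> : 2 * (side Q / 2 ^+ n) * K = 2 * side Q * K / 2 ^+ n.
  by rewrite mulrA mulrAC.
by move: h1; rewrite !ler_pdivrMr// (mulrC eps).
Qed.

Let vanishingC Q E : vanishing Q E -> vanishing Q (~` E).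
Proof.
move=> [mE vE]; split; first exact: measurableC.
by move=> eps /vE[N hN]; exists N => n; rewrite straddleC; exact: hN.
Qed.

Let vanishing0 Q : vanishing Q set0.
Proof.
split=> // eps e0; exists 0 => n _.
rewrite (_ : straddle n set0 Q = 0%E) ?lee_fin 1?ltW//.
elim: n Q => [Q|n IH Q] /=; last by rewrite big1// => e _; exact: IH.
by rewrite set0I measure0; apply/min_idPl; rewrite measure_ge0.
Qed.

Let vanishingU Q E F : vanishing Q E -> vanishing Q F -> vanishing Q (E `|` F).
Proof.
move=> [mE vE] [mF vF]; split; first exact: measurableU.
move=> eps e0; have e2 : 0 < eps / 2 by rewrite divr_gt0.
have [N hN] := vE _ e2; have [M hM] := vF _ e2; exists (maxn N M) => n.
rewrite geq_max => /andP[Nn Mn]; apply: (le_trans (straddleU _ _ mE mF)).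
by rewrite [eps]splitr EFinD leeD// ?hN ?hM.
Qed.

Let vanishing_bigcup Q (F : (set (euclid R d))^nat) : 0 < side Q ->
  (forall k, vanishing Q (F k)) -> vanishing Q (\bigcup_k F k).
Proof.
move=> l0 vF; have mF k : measurable (F k) by have [] := vF k.
have mUF : measurable (\bigcup_k F k) by exact: bigcup_measurable.
split=> // eps e0; have e2 : 0 < eps / 2 by rewrite divr_gt0.
pose U K := \big[setU/set0]_(k < K) F k.
have vU K : vanishing Q (U K).
  rewrite /U; elim: K => [|K IH]; first by rewrite big_ord0; exact: vanishing0.
  by rewrite big_ord_recr; exact: vanishingU.
have mU K : measurable (U K) by have [] := vU K.
have UE K : U K `<=` \bigcup_k F k.
  by rewrite /U -bigcup_mkord; move=> x [k _ Fx]; exists k.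
pose G K := (\bigcup_k F k `\` U K) `&` cube_set Q.
have mG K : measurable (G K) by apply: mI; exact: measurableD.
have G0 : \bigcap_K G K = set0.
  apply/seteqP; split=> // x Gx; have [[[k _ Fkx] _] _] := Gx 0 I.
  have [[_ nUx] _] := Gx k.+1 I; apply: nUx.
  by rewrite /U -bigcup_mkord; exists k => /=.
(* Continuity from above is available because everything is confined to a cube of finite measure. *)
have : (mu \o G) K @[K --> \oo] --> mu (\bigcap_K G K).
  apply: nonincreasing_cvg_mu => //.
  - apply: (@le_lt_trans _ _ (mu (cube_set Q))).
      by apply: le_mu => //; [exact: measurable_cube|apply: subIsetr].
    by rewrite lebesgue_cube ?ltW// ltry.
  - by rewrite G0.
  - move=> m n mn; apply/subsetPset => x [[Ux nUx] Qx]; split => //; split => //.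
    apply: contra_not nUx; rewrite /U -!bigcup_mkord => -[k /= km Fkx].
    by exists k => //=; exact: leq_trans mn.
rewrite G0 measure0 => /fine_cvgP[[K1 _ h1] /cvgrPdist_le/(_ _ e2)[K2 _ h2]].
pose K := maxn K1 K2.
have hK : (mu (G K) <= (eps / 2)%:E)%E.
  have f1 : mu (G K) \is a fin_num by apply: h1; exact: leq_maxl.
  have := h2 K (leq_maxr _ _); rewrite /= sub0r normrN ger0_norm ?fine_ge0//.
  by rewrite -lee_fin fineK.
have [_ /(_ _ e2)[N hN]] := vU K; exists N => n /hN h.
apply: (le_trans (straddle_sub n l0 mUF (mU K) (UE K))).
by rewrite [eps]splitr EFinD leeD.
Qed.

Let sigma_algebra_vanishing Q : 0 < side Q ->
  sigma_algebra setT (vanishing Q).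
Proof.
move=> l0; split; first exact: vanishing0.
- by move=> A; rewrite setTD; exact: vanishingC.
- by move=> A; exact: vanishing_bigcup.
Qed.

(** The good sets form a sigma-algebra containing the half-spaces. Generation is used twice:
    coordinate preimages generate the product sigma-algebra, and open half-lines generate the Borel
    sets of the line. *)
Lemma straddle_vanishes Q E : 0 < side Q -> measurable E ->
  forall eps : R, 0 < eps -> exists n, (straddle n E Q <= eps%:E)%E.
Proof.
move=> l0 mE; suff [_ vE] : vanishing Q E.
  by move=> eps /vE[N hN]; exists N; exact: hN.
move: mE; apply: smallest_sub; first exact: sigma_algebra_vanishing.
move=> A; rewrite -bigcup_seq => -[i _ [B mB <-]]; rewrite setTI.
pose S := [set C : set (measurableTypeR R) | vanishing Q ((fun x => tnth x i) @^-1` C)].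
suff : S B by [].
have : (@RGenInftyO.G R).-sigma.-measurable B by rewrite -RGenInftyO.measurableE.
apply: smallest_sub.
  split.
  - by rewrite /S/= preimage_set0; exact: vanishing0.
  - by move=> C; rewrite /S/= setTD preimage_setC; exact: vanishingC.
  - by move=> C hC; rewrite /S/= preimage_bigcup; exact: vanishing_bigcup.
by move=> _ [a ->]; rewrite /S/=; exact: vanishing_halfspace.
Qed.

End straddling_cells.

(** * The John-Nirenberg inequality *)

Section john_nirenberg.
Context {R : realType} {d : nat}.
Local Notation mu := (lebesgue R d).
Implicit Types (Q P : cube R d) (A E F : set (euclid R d)).

Lemma average_dist (b : euclid R d -> R) Q (a : R) : 0 < side Q ->
  mu.-integrable (cube_set Q) (EFin \o b) ->
  ((`|average Q b - a| * vol Q)%:E <=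
   \int[mu]_(x in cube_set Q) `|b x - a|%:E)%E.
Proof.
move=> l0 ib; have mQ := measurable_cube Q.
have fQ : (mu (cube_set Q) < +oo)%E by rewrite lebesgue_cube ?ltW// ltry.
have ic : mu.-integrable (cube_set Q) (EFin \o cst a).
  apply/integrableP; split; first by apply/measurable_EFinP; exact: measurable_cst.
  by rewrite /= (integral_cst mu mQ `|a|%:E) lte_mul_pinfty// ?ltry// lee_fin.
have ibc : mu.-integrable (cube_set Q) (EFin \o (fun x => b x - a)).
  rewrite (_ : _ \o _ = (EFin \o b) \- (EFin \o cst a))%E//.
  exact: integrableB.
have v0 := vol_gt0 l0.
have <- : `|\int[mu]_(x in cube_set Q) (b x - a)|%:E =
   (`|average Q b - a| * vol Q)%:E.
  rewrite -[X in _ * X](gtr0_norm v0) -normrM RintegralB// Rintegral_cst//.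
  congr (`| _ |%:E); rewrite /average.
  by rewrite mulrBl (mulrC (vol Q)^-1) divfK// gt_eqF.
apply: (@le_trans _ _ (\int[mu]_(x in cube_set Q) `|b x - a|)%:E).
  by rewrite lee_fin; exact: le_normr_Rintegral.
rewrite /Rintegral fineK// integrable_fin_num//.
exact: integrable_norm.
Qed.

(** The norm is replaced by an upper bound [B], which can be taken positive even for constant [b],
    and averages by extended integrals, which do not pass through [fine]. *)
Definition bmo_bounded (b : euclid R d -> R) (B : R) : Prop :=
  [/\ measurable_fun setT b, forall Q, mu.-integrable (cube_set Q) (EFin \o b) &
   forall Q, 0 < side Q ->
   (\int[mu]_(x in cube_set Q) `|b x - average Q b|%:E <= (B * vol Q)%:E)%E].

Section step.
Variables (b : euclid R d -> R) (B : R).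
Hypotheses (B0 : 0 < B) (bB : bmo_bounded b B).

Let mb : measurable_fun setT b. Proof. by have [] := bB. Qed.
Let ib Q : mu.-integrable (cube_set Q) (EFin \o b).
Proof. by have [_ + _] := bB; exact. Qed.
Let bmoB Q : 0 < side Q ->
  (\int[mu]_(x in cube_set Q) `|b x - average Q b|%:E <= (B * vol Q)%:E)%E.
Proof. by have [_ _ +] := bB; exact. Qed.

Definition distant (t a : R) : set (euclid R d) := [set x | t < `|b x - a|].

Definition jn_tail (t c : R) := forall Q, 0 < side Q ->
  (mu (distant t (average Q b) `&` cube_set Q) <= (c * vol Q)%:E)%E.

(** The sum of two thresholds: 2^d * 2B bounds the shift of the average on a stopping cube, and 2 *
    2B makes Chebyshev's inequality leave at most half of a cube above the level. *)
Definition jn_gap : R := 2 * (2 ^+ d + 2) * B.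

Lemma measurable_dist (a : R) : measurable_fun setT (fun x => `|b x - a|).
Proof.
apply: measurableT_comp => //.
by apply: measurable_funB => //; exact: measurable_cst.
Qed.

Lemma measurable_distant t a : measurable (distant t a).
Proof.
rewrite -[X in measurable X]setTI.
rewrite (_ : distant t a = (fun x => `|b x - a|) @^-1` `]t, +oo[%classic); last first.
  by apply/seteqP; split=> x /=; rewrite in_itv/= andbT.
exact: measurable_dist.
Qed.

Let dist_int Q (a : R) : (0 <= \int[mu]_(x in cube_set Q) `|b x - a|%:E)%E.
Proof. by apply: integral_ge0 => x _; rewrite lee_fin. Qed.

Let chebyshev Q (a t : R) : 0 <= t -> (t%:E * mu (distant t a `&` cube_set Q)
  <= \int[mu]_(x in cube_set Q) `|b x - a|%:E)%E.
Proof.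
move=> t0; have mQ := measurable_cube Q; have mD := measurable_distant t a.
have mh := measurable_dist a.
rewrite -integral_indic// -ge0_integralZl//; last first.
  apply/measurable_EFinP; exact: measurable_indic.
apply: ge0_le_integral => //.
- by move=> x _; rewrite -EFinM lee_fin mulr_ge0.
- apply/measurable_EFinP; apply: measurable_funM => //; exact: measurable_indic.
- by apply/measurable_EFinP; exact: measurable_funTS.
move=> x _; rewrite -EFinM lee_fin indicE.
case: (boolP (x \in distant t a)) => [|_]; rewrite ?mulr0// inE /distant/= => h.
by rewrite mulr1 ltW.
Qed.

(* A stopping-time argument at height [2 * B]: on a subcube where the average of
   [|b - a|] exceeds it, that average is at most [2 ^+ d] times larger and the
   tail hypothesis applies; the subcubes of the last generation are absorbed by
   [straddle], since [|b - a|] is mostly below the threshold there. *)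
Let stopping_time (t c a : R) n Q : 0 <= t -> 0 <= c -> jn_tail t c -> 0 < side Q ->
  (\int[mu]_(x in cube_set Q) `|b x - a|%:E <= (2 * B * vol Q)%:E)%E ->
  (mu (distant (t + jn_gap) a `&` cube_set Q) <=
   (c / (2 * B))%:E * \int[mu]_(x in cube_set Q) `|b x - a|%:E +
   straddle n (distant (t + jn_gap) a) Q)%E.
Proof.
move=> t0 c0 tailc; set E := distant _ _.
have mE : measurable E by exact: measurable_distant.
have mh := measurable_dist a.
have B2 : 0 < 2 * B by rewrite mulr_gt0.
have d1 : 1 <= (2 : R) ^+ d by rewrite exprn_ege1// ler1n.
have cB : 0 <= c / (2 * B) by rewrite divr_ge0// ltW.
have gap4 : 2 * (2 * B) <= jn_gap.
  by rewrite /jn_gap; nra.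
elim: n Q => [|n IH] Q l0 hQ /=.
  have mQ := measurable_cube Q.
  have fE : mu (E `&` cube_set Q) \is a fin_num.
    rewrite ge0_fin_numE// (@le_lt_trans _ _ (mu (cube_set Q)))//.
      by rewrite le_measure ?inE//; exact: measurableI.
    by rewrite lebesgue_cube ?ltW// ltry.
  have fC : mu (~` E `&` cube_set Q) \is a fin_num.
    rewrite ge0_fin_numE// (@le_lt_trans _ _ (mu (cube_set Q)))//.
      by rewrite le_measure ?inE//; apply: measurableI => //; exact: measurableC.
    by rewrite lebesgue_cube ?ltW// ltry.
  have tot : (mu (E `&` cube_set Q) + mu (~` E `&` cube_set Q) = (vol Q)%:E)%E.
    rewrite -lebesgue_cubeE ?ltW// -measureU//; first last.
    - by rewrite setIACA setICr set0I.
    - by apply: measurableI => //; exact: measurableC.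
    - exact: measurableI.
    - by rewrite -setIUl setUv setTI.
  (* By Chebyshev's inequality E fills at most half of Q, so the minimum defining [straddle 0] is
     the inside part. *)
  have ch : ((2 * (2 * B))%:E * mu (E `&` cube_set Q) <= (2 * B * vol Q)%:E)%E.
    apply: le_trans hQ; apply: (le_trans _ (@chebyshev Q a (t + jn_gap) _)).
      by apply: lee_wpmul2r => //; rewrite lee_fin; lra.
    by rewrite addr_ge0//; lra.
  rewrite (_ : Order.min _ _ = mu (E `&` cube_set Q)).
    by rewrite leeDr// mule_ge0.
  apply/min_idPl; move: tot ch; rewrite -(fineK fE) -(fineK fC) -EFinD -EFinM.
  move=> [tot]; rewrite !lee_fin -tot; nra.
rewrite (measure_children l0 mE) ge0_integral_children//; last first.
  exact: measurable_funTS.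
rewrite ge0_sume_distrr; last by move=> e _; exact: dist_int.
rewrite -big_split/=; apply: lee_sum => e _.
have l0' := side_child_gt0 e l0.
have [h|h] := leP (\int[mu]_(x in cube_set (child Q e)) `|b x - a|%:E)%E
   (2 * B * vol (child Q e))%:E.
  exact: IH.
have mQ := measurable_cube (child Q e).
apply: (@le_trans _ _ (c * vol (child Q e))%:E).
  apply: le_trans (tailc _ l0'); rewrite le_measure ?inE//.
    exact: measurableI.
    apply: measurableI => //; exact: measurable_distant.
  move=> x [Ex Qx]; split => //; rewrite /distant/=.
  (* The parent still satisfies [hQ], and its volume is 2^d times that of the child. *)
  have : `|average (child Q e) b - a| <= 2 ^+ d * (2 * B).
    rewrite -(ler_pM2r (vol_gt0 l0')) -lee_fin.
    apply: (le_trans (average_dist a l0' (ib _))).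
    apply: (@le_trans _ _ (\int[mu]_(x in cube_set Q) `|b x - a|%:E)%E).
      apply: ge0_subset_integral => //; first exact: measurable_cube.
        by apply/measurable_EFinP; exact: measurable_funTS.
      exact: child_sub.
    by rewrite (le_trans hQ)// lee_fin (vol_child e l0) mulrCA mulrA.
  move: Ex; rewrite /E /distant/= => Ex h1.
  have : `|b x - a| <= `|b x - average (child Q e) b| + `|average (child Q e) b - a|.
    by rewrite (le_trans _ (ler_normD _ _))// addrA subrK.
  move: Ex h1; rewrite /jn_gap; lra.
(* The volume of a stopping cube is paid for by the integral over it, which exceeds 2B times that
   volume by [h]. *)
apply: (@le_trans _ _ ((c / (2 * B))%:E * (2 * B * vol (child Q e))%:E)%E).
  by rewrite -EFinM lee_fin mulrA divfK// gt_eqF.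
apply: (@le_trans _ _ ((c / (2 * B))%:E *
  \int[mu]_(x in cube_set (child Q e)) `|b x - a|%:E)%E).
  by apply: lee_wpmul2l => //; exact: ltW.
by rewrite leeDl// straddle_ge0.
Qed.

(** The gain of 1/2 comes from stopping at twice the mean oscillation: the integral over Q is at
    most B times the volume, and it is multiplied by c / (2B). The [straddle] term is made
    arbitrarily small by the choice of generation. *)
Lemma jn_tail_step (t c : R) : 0 <= t -> 0 <= c -> jn_tail t c ->
  jn_tail (t + jn_gap) (c / 2).
Proof.
move=> t0 c0 tailc Q l0; set a := average Q b; set E := distant _ _.
have mE : measurable E by exact: measurable_distant.
have mh := measurable_dist a.
have B2 : 0 < 2 * B by rewrite mulr_gt0.
have v0 := vol_gt0 l0.
apply/lee_addgt0Pr => eps e0.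
have [n hn] := straddle_vanishes l0 mE e0.
have hQ := bmoB l0.
apply: (le_trans (stopping_time (a := a) n t0 c0 tailc l0 _)).
  by rewrite (le_trans hQ)// lee_fin; nra.
apply: leeD => //.
apply: (@le_trans _ _ ((c / (2 * B))%:E * (B * vol Q)%:E)%E).
  by apply: lee_wpmul2l => //; rewrite lee_fin divr_ge0// ltW.
rewrite -EFinM lee_fin mulrA ler_pM2r// invfM -!mulrA mulVf ?gt_eqF//; lra.
Qed.

Lemma jn_tail_geometric k : jn_tail (jn_gap *+ k) (2^-1 ^+ k).
Proof.
have g0 : 0 <= jn_gap by rewrite /jn_gap !mulr_ge0 ?ltW// ?addr_ge0// exprn_ge0.
elim: k => [|k IH].
  move=> Q l0; rewrite expr0 mul1r -(lebesgue_cubeE (ltW l0)).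
  have mQ := measurable_cube Q.
  by rewrite le_measure ?inE//; apply: measurableI => //; exact: measurable_distant.
rewrite mulrSr exprSr; apply: jn_tail_step IH; rewrite ?mulrn_wge0// exprn_ge0//.
Qed.

End step.
End john_nirenberg.
Arguments jn_gap {R} d B.

(** * Exponential integrability of the oscillation *)

Section exponential_integrability.
Context {R : realType} {d : nat}.
Local Notation mu := (lebesgue R d).
Variables (b : euclid R d -> R) (B : R).
Hypotheses (B0 : 0 < B) (bB : bmo_bounded b B).

Let mb : measurable_fun setT b. Proof. by have [] := bB. Qed.

Lemma jn_gap_gt0 : 0 < jn_gap d B.
Proof.
have d0 : 0 <= (2 : R) ^+ d by rewrite exprn_ge0.
by rewrite /jn_gap !mulr_gt0//; lra.
Qed.

(* Any base between 1 and 2 is summable against the tails [2^-1 ^+ k]. *)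
Definition jn_weight (Q : cube R d) (x : euclid R d) : R :=
  (3 / 2) `^ (`|b x - average Q b| / jn_gap d B).

Lemma measurable_jn_weight Q : measurable_fun setT (jn_weight Q).
Proof.
apply: (measurableT_comp (measurable_powRr (3 / 2 : R))).
by apply: measurable_funM; [exact: (measurable_dist bB)|exact: measurable_cst].
Qed.

(** The exponent is k + 2 because layer k must dominate the weight where the normalised oscillation
    lies in [k + 1, k + 2[. Starting at k + 1 gives the strict inequality in [distant]; oscillations
    below 1 are left to the constant 3/2 of [weight_layers]. *)
Let layer Q (k : nat) (x : euclid R d) : R :=
  (3 / 2) ^+ k.+2 * \1_(distant b (jn_gap d B *+ k) (average Q b)) x.

Let layer_ge0 Q k x : 0 <= layer Q k x.
Proof. by rewrite mulr_ge0// exprn_ge0// divr_ge0. Qed.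

Let measurable_layer Q k : measurable_fun setT (layer Q k).
Proof.
apply: measurable_funM; first exact: measurable_cst.
by apply: measurable_indic; exact: (measurable_distant bB).
Qed.

Let weight_layers Q x :
  ((jn_weight Q x)%:E <= (3 / 2)%:E + \sum_(0 <= k <oo) (layer Q k x)%:E)%E.
Proof.
have g0 := jn_gap_gt0.
set a := `|b x - average Q b| / jn_gap d B.
have a0 : 0 <= a by rewrite divr_ge0// ltW.
have layer0 k : (0 <= (layer Q k x)%:E)%E by rewrite lee_fin.
have /andP[ma am] := truncn_itv a0.
have wle : jn_weight Q x <= (3 / 2) ^+ (Num.truncn a).+1.
  by rewrite -powR_mulrn ?divr_ge0// ler_powR ?ltW//; lra.
move: ma wle; case: (Num.truncn a) => [|j] ma wle.
  rewrite expr1 in wle.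
  by rewrite (@le_trans _ _ (3 / 2)%:E) ?lee_fin// leeDl// nneseries_ge0.
apply: (@le_trans _ _ (layer Q j x)%:E).
  rewrite lee_fin (le_trans wle)// /layer indicE mem_set ?mulr1//=.
  rewrite /distant/= -mulr_natl -ltr_pdivlMr// -/a.
  by rewrite (lt_le_trans _ ma)// ltr_nat.
rewrite -[X in (X <= _)%E]add0e; apply: leeD; first by rewrite lee_fin divr_ge0.
rewrite (le_trans _ (nneseries_lim_ge j.+1 _))//.
by rewrite big_nat_recr//= leeDr// sume_ge0.
Qed.

Let geometric_sum n :
  \sum_(0 <= k < n) (9 / 4 * (3 / 4) ^+ k) = 9 * (1 - (3 / 4) ^+ n) :> R.
Proof.
elim: n => [|n IH]; first by rewrite big_nil expr0 subrr mulr0.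
by rewrite big_nat_recr//= IH exprS; lra.
Qed.

(** The constant is 3/2 + 9, where 9 is the sum over k of (3/2)^(k+2) * 2^-k = 9/4 * (3/4)^k. *)
Lemma jn_exponential Q : 0 < side Q ->
  (\int[mu]_(x in cube_set Q) (jn_weight Q x)%:E <= (21 / 2 * vol Q)%:E)%E.
Proof.
move=> l0; have mQ := measurable_cube Q.
have mL k : measurable_fun (cube_set Q) (EFin \o layer Q k).
  by apply/measurable_EFinP; exact: measurable_funTS.
pose S (x : euclid R d) : \bar R := (\sum_(0 <= k <oo) (layer Q k x)%:E)%E.
have mS : measurable_fun (cube_set Q) S.
  by apply: ge0_emeasurable_sum => [k x _ _|k _]; rewrite ?lee_fin//; exact: mL.
have S0 x : (0 <= S x)%E.
  by apply: nneseries_ge0 => k _ _; rewrite lee_fin.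
apply: (@le_trans _ _ (\int[mu]_(x in cube_set Q) ((3 / 2)%:E + S x))%E).
  apply: ge0_le_integral => //.
  - by move=> x _; rewrite lee_fin powR_ge0.
  - by apply/measurable_EFinP; apply: measurable_funTS; exact: measurable_jn_weight.
  - by apply: emeasurable_funD => //; exact: measurable_cst.
  - by move=> x _; exact: weight_layers.
rewrite ge0_integralD//.
have -> : (\int[mu]_(x in cube_set Q) (3 / 2)%:E = (3 / 2 * vol Q)%:E)%E.
  rewrite (integral_cst mu mQ (3 / 2)%:E) (EFinM (3 / 2)).
  by rewrite -(lebesgue_cubeE (ltW l0)).
rewrite integral_nneseries//; last by move=> k x _; rewrite lee_fin.
have -> : 21 / 2 * vol Q = 3 / 2 * vol Q + 9 * vol Q by lra.
rewrite EFinD; apply: leeD => //.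
apply: lime_le.
  apply: is_cvg_nneseries => k _ _; apply: integral_ge0 => x _; rewrite lee_fin//.
near=> n; apply: (@le_trans _ _
  (\sum_(0 <= k < n) (9 / 4 * (3 / 4) ^+ k * vol Q)%:E)%E).
  apply: lee_sum => k _; rewrite /layer.
  under eq_integral do rewrite EFinM.
  have mD := measurable_distant bB (jn_gap d B *+ k) (average Q b).
  rewrite ge0_integralZl//; last by apply/measurable_EFinP; exact: measurable_indic.
  rewrite integral_indic//.
  apply: (@le_trans _ _ (((3 / 2) ^+ k.+2)%:E * (2^-1 ^+ k * vol Q)%:E)%E).
    apply: lee_wpmul2l; first by rewrite lee_fin exprn_ge0// divr_ge0.
    exact: (jn_tail_geometric B0 bB).
  rewrite -EFinM lee_fin mulrA ler_pM2r ?vol_gt0//.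
  have -> : 3 / 4 = 3 / 2 / 2 :> R by lra.
  by rewrite (exprMn k (3 / 2) 2^-1) !exprS; lra.
rewrite sumEFin -mulr_suml geometric_sum lee_fin ler_pM2r ?vol_gt0//.
have h : 0 <= (3 / 4 : R) ^+ n by rewrite exprn_ge0// divr_ge0.
lra.
Unshelve. all: by end_near. Qed.

End exponential_integrability.

(** * Oscillation factors absorbed into L^r averages *)

Section local_bound.
Context {R : realType} {d : nat}.
Local Notation mu := (lebesgue R d).

Lemma powR_le_max (s z : R) : 0 <= s <= 1 -> 0 <= z -> z `^ s <= Num.max 1 z.
Proof.
move=> /andP[s0 s1] z0; rewrite le_max; have [z1|z1] := leP z 1.
  have : z `^ s <= 1 `^ s by rewrite ge0_ler_powR// nnegrE.
  by rewrite powR1 => ->.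
by rewrite orbC ler1_powR// ltW.
Qed.

(* [23 / 2] is the constant of [jn_exponential] plus the contribution of [f] in
   Young's inequality. *)
Definition local_cst (r : R) : R :=
  23 / 2 * (2 * (2 ^+ d + 2)) * Num.max 1 (r / (r - 1) / ln (3 / 2)).

Lemma local_cst_gt0 r : 0 < local_cst r.
Proof.
have d0 : 0 <= (2 : R) ^+ d by rewrite exprn_ge0.
have h : 0 < Num.max 1 (r / (r - 1) / ln (3 / 2)) by rewrite lt_max ltr01.
by rewrite /local_cst !mulr_gt0//; lra.
Qed.

(** An exponential dominates powers: up to constants, |b - c|^s is at most B^s times the power 1/q
    of [jn_weight], with q conjugate to r. Young's inequality then separates the weight from
    |f|^r. *)
Lemma local_power_bound (b : euclid R d -> R) (B r s : R) (f : euclid R d -> R)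
    (Q : cube R d) (y : R) :
  0 < B -> bmo_bounded b B -> 1 < r -> 0 <= s <= 1 -> measurable_fun setT f ->
  0 < side Q -> 0 <= y ->
  (\int[mu]_(x in cube_set Q) (`|f x| `^ r)%:E <= (y `^ r * vol Q)%:E)%E ->
  (\int[mu]_(x in cube_set Q) (`|b x - average Q b| `^ s * `|f x|)%:E <=
   (local_cst r * B `^ s * y * vol Q)%:E)%E.
Proof.
move=> B0 bB r1 s01 mf l0 y0 hf; have mQ := measurable_cube Q.
have v0 := vol_gt0 l0; have /andP[s0 s1] := s01.
(* Young's inequality is applied to |f| / w, so [y] is replaced by a positive majorant; the case y =
   0 follows by letting w tend to 0. *)
suff main w : 0 < w -> y <= w ->
  (\int[mu]_(x in cube_set Q) (`|b x - average Q b| `^ s * `|f x|)%:E <=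
   (local_cst r * B `^ s * w * vol Q)%:E)%E.
  have [y00|y00] := ltP 0 y; first exact: main.
  have -> : y = 0 by apply/eqP; rewrite eq_le y00.
  rewrite mulr0 mul0r; apply/lee_addgt0Pr => eps e0; rewrite add0e.
  pose k := local_cst r * B `^ s * vol Q.
  have k0 : 0 < k by rewrite mulr_gt0// mulr_gt0 ?local_cst_gt0// powR_gt0.
  apply: (le_trans (main (eps / k) _ _)).
  - by rewrite divr_gt0.
  - by rewrite (le_trans y00)// ltW// divr_gt0.
  - by rewrite lee_fin mulrAC -/k mulrCA divff ?mulr1// gt_eqF.
move=> w0 yw.
set c := average Q b; pose g := jn_gap d B; have g0 : 0 < g by exact: jn_gap_gt0.
pose q := r / (r - 1); have q0 : 0 < q by rewrite divr_gt0//; lra.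
pose eta : R := ln (3 / 2); have eta0 : 0 < eta by rewrite ln_gt0//; lra.
pose kappa := Num.max 1 (q / eta).
have kappa1 : 1 <= kappa by rewrite le_max lexx.
pose L : R := 2 * (2 ^+ d + 2).
have L1 : 1 <= L.
  by have : 0 <= (2 : R) ^+ d by [rewrite exprn_ge0]; rewrite /L; lra.
have gE : g = L * B by [].
have kappaq : q / eta <= kappa by rewrite le_max lexx orbT.
have cE : local_cst r = 23 / 2 * L * kappa by [].
clearbody kappa L.
have dist_le x : `|b x - c| `^ s <= B `^ s * (L * kappa) * (jn_weight b B Q x) `^ q^-1.
  rewrite /jn_weight -/c -/g; set a := `|b x - c| / g.
  have a0 : 0 <= a by rewrite divr_ge0// ltW.
  have -> : `|b x - c| = B * (L * a).
    by rewrite mulrA (mulrC B) -gE mulrC divfK// gt_eqF.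
  have La0 : 0 <= L * a by rewrite mulr_ge0//; lra.
  rewrite powRM ?(ltW B0)// -mulrA ler_pM2l ?powR_gt0//.
  rewrite (le_trans (powR_le_max s01 La0))//.
  (* The right-hand side is exp(a * eta / q), and exp(t) >= 1 + t. It thus dominates both 1 and a
     multiple of a, the two terms of the maximum that bounds (L * a)^s. *)
  have hw : 1 + a * eta / q <= ((3 / 2) `^ a) `^ q^-1.
    rewrite -powRrM {1}/powR ifF; last by apply/negbTE; rewrite gt_eqF//; lra.
    by rewrite (le_trans _ (expR_ge1Dx _))// mulrAC.
  have aq0 : 0 <= a * eta / q by exact: divr_ge0 (mulr_ge0 a0 (ltW eta0)) (ltW q0).
  rewrite ge_max; apply/andP; split.
    rewrite -[leLHS]mulr1; apply: ler_pM => //; last by rewrite (le_trans _ hw)// lerDl.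
    by rewrite -[leLHS]mulr1 ler_pM.
  rewrite -mulrA; apply: ler_wpM2l; first by lra.
  apply: (@le_trans _ _ (q / eta * (a * eta / q))).
    by rewrite mulrC -(mulrA (a * eta)) mulKf ?gt_eqF// mulfK// gt_eqF.
  apply: ler_pM => //; first by rewrite divr_ge0// ltW.
  by rewrite (le_trans _ hw)// lerDr.
have pt x : `|b x - c| `^ s * `|f x| <=
   B `^ s * (L * kappa) * w * (jn_weight b B Q x + `|f x| `^ r / w `^ r).
  have q1 : 1 <= q by rewrite ler_pdivlMr; lra.
  have jw0 : 0 <= jn_weight b B Q x by exact: powR_ge0.
  pose z := `|f x| / w; have z0 : 0 <= z by rewrite divr_ge0// ltW.
  have fE : `|f x| = z * w by rewrite divfK// gt_eqF.
  clearbody z; have -> : `|f x| `^ r / w `^ r = z `^ r.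
    by rewrite fE powRM ?(ltW w0)// mulfK// gt_eqF// powR_gt0.
  have r0 : 0 < r by lra.
  have qr : q^-1 + r^-1 = 1.
    by rewrite invf_div mulrBl mul1r divff ?gt_eqF// subrK.
  have := conjugate_powR (powR_ge0 (jn_weight b B Q x) q^-1) z0 q0 r0 qr.
  rewrite -powRrM mulVf ?gt_eqF// powRr1// => young.
  have k0 : 0 <= B `^ s * (L * kappa) by rewrite !mulr_ge0 ?powR_ge0//; lra.
  apply: (@le_trans _ _ (B `^ s * (L * kappa) *
     (jn_weight b B Q x) `^ q^-1 * `|f x|)); first exact: ler_wpM2r.
  rewrite fE -!mulrA; apply: ler_wpM2l; first exact: powR_ge0.
  apply: ler_wpM2l; first by lra.
  apply: ler_wpM2l; first by lra.
  rewrite mulrA mulrC; apply: ler_wpM2l; first exact: ltW.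
  rewrite (le_trans young)//; apply: lerD.
    by rewrite ler_pdivrMr// ler_peMr.
  by rewrite ler_pdivrMr// ler_peMr ?powR_ge0// ltW.
have wr0 : 0 < w `^ r by rewrite powR_gt0.
pose K1 := B `^ s * (L * kappa) * w.
have K10 : 0 <= K1 by rewrite !mulr_ge0 ?powR_ge0// ?ltW//; lra.
have mfr : measurable_fun (cube_set Q) (fun x => `|f x| `^ r).
  apply: measurable_funTS; apply: (measurableT_comp (measurable_powR r)).
  exact: measurableT_comp.
have mjw : measurable_fun (cube_set Q) (jn_weight b B Q).
  by apply: measurable_funTS; exact: measurable_jn_weight.
apply: (@le_trans _ _ (\int[mu]_(x in cube_set Q)
    (K1%:E * ((jn_weight b B Q x)%:E + (w `^ r)^-1%:E * (`|f x| `^ r)%:E)))%E).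
  apply: ge0_le_integral => //.
  - apply/measurable_EFinP; apply: measurable_funTS; apply: measurable_funM.
      by apply: (measurableT_comp (measurable_powR s)); exact: (measurable_dist bB).
    exact: measurableT_comp.
  - apply/measurable_EFinP; apply: measurable_funM => //.
    apply: measurable_funD => //; exact: measurable_funM.
  - move=> x _; rewrite (muleC (w `^ r)^-1%:E).
    by rewrite -[leRHS]/(K1 * (jn_weight b B Q x + `|f x| `^ r / w `^ r))%:E lee_fin.
have wr1 : 0 <= (w `^ r)^-1 by rewrite invr_ge0 ltW.
rewrite ge0_integralZl//; last 2 first.
- apply/measurable_EFinP; apply: measurable_funD => //; exact: measurable_funM.
- by move=> x _; rewrite -EFinM -EFinD lee_fin addr_ge0 ?mulr_ge0 ?powR_ge0.
rewrite ge0_integralD//; last 4 first.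
- by move=> x _; rewrite lee_fin powR_ge0.
- exact/measurable_EFinP.
- by move=> x _; rewrite -EFinM lee_fin mulr_ge0 ?powR_ge0.
- by apply/measurable_EFinP; exact: measurable_funM.
rewrite ge0_integralZl//; last exact/measurable_EFinP.
apply: (@le_trans _ _ (K1%:E * ((21 / 2 * vol Q)%:E + (vol Q)%:E))%E).
  apply: lee_wpmul2l; first by rewrite lee_fin.
  apply: leeD; first exact: jn_exponential.
  apply: (@le_trans _ _ ((w `^ r)^-1%:E * (y `^ r * vol Q)%:E)%E).
    by apply: lee_wpmul2l => //; rewrite lee_fin.
  rewrite -EFinM lee_fin mulrA ler_piMl ?(ltW v0)// mulrC ler_pdivrMr// mul1r.
  by rewrite ge0_ler_powR ?nnegrE ?(ltW w0)//; lra.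
rewrite -EFinD -EFinM lee_fin /K1 cE; lra.
Qed.

End local_bound.
Arguments local_cst {R} d r.

(** * The Carleson embedding theorem *)

Section carleson_embedding.
Context {R : realType} {d : nat}.
Local Notation mu := (lebesgue R d).

Lemma seq_argmax (I : eqType) (f : I -> R) (s : seq I) : s != [::] ->
  exists2 i, i \in s & forall j, j \in s -> f j <= f i.
Proof.
elim: s => // i [_ _|k s IH _].
  by exists i; rewrite ?inE// => j; rewrite inE => /eqP ->.
have [//|m ms hm] := IH; have [h|h] := leP (f m) (f i).
  exists i; first by rewrite inE eqxx.
  by move=> j; rewrite inE => /predU1P[->//|/hm/le_trans]; exact.
exists m; first by rewrite inE ms orbT.
by move=> j; rewrite inE => /predU1P[->|/hm//]; exact: ltW.
Qed.

(** A growing geometric sum is controlled by its last term, here below Z, so neither the starting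
    point [a] nor the length [K] enters the bound. *)
Lemma geometric_below (theta a Z : R) K : 1 < theta -> 0 < a -> 0 <= Z ->
  \sum_(j < K | a * theta ^+ j < Z) a * theta ^+ j <= Z * theta / (theta - 1).
Proof.
(* The minimum carries the induction: a term that is added must fit under a * theta^K, while Z *
   theta takes over once the terms have passed Z. *)
move=> t1 a0 Z0; suff : \sum_(j < K | a * theta ^+ j < Z) a * theta ^+ j <=
    Num.min (Z * theta) (a * theta ^+ K) / (theta - 1).
  move/le_trans; apply; rewrite ler_pM2r ?invr_gt0 ?subr_gt0//.
  by rewrite ge_min lexx.
have t0 : 0 < theta - 1 by lra.
elim: K => [|K IH].
  rewrite big_ord0 divr_ge0 ?(ltW t0)// le_min !mulr_ge0 ?exprn_ge0//; lra.
rewrite big_mkcond big_ord_recr/= -big_mkcond/=.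
have aK : a * theta ^+ K.+1 = a * theta ^+ K * theta by rewrite exprSr mulrA.
have aK0 : 0 < a * theta ^+ K by rewrite mulr_gt0// exprn_gt0//; lra.
case: ifPn => [h|_]; last first.
  rewrite addr0 (le_trans IH)// ler_pM2r ?invr_gt0// aK le_min !ge_min lexx/=.
  by rewrite orbC ler_peMr// ltW.
have -> : Num.min (Z * theta) (a * theta ^+ K.+1) = a * theta ^+ K.+1.
  by apply/min_idPr; rewrite aK ler_pM2r; lra.
have : \sum_(j < K | a * theta ^+ j < Z) a * theta ^+ j <=
    a * theta ^+ K / (theta - 1).
  by rewrite (le_trans IH)// ler_pM2r ?invr_gt0// ge_min lexx orbT.
rewrite -(lerD2r (a * theta ^+ K)) => /le_trans; apply.
rewrite aK -[X in _ + X](mulfK (lt0r_neq0 t0)) -mulrDl ler_pM2r ?invr_gt0//; lra.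
Qed.

Lemma two_powR_gt1 (a : R) : 0 < a -> 1 < 2 `^ a.
Proof.
move=> a0; have : 1 `^ a < 2 `^ a by rewrite gt0_ltr_powR ?nnegrE// ltr1n.
by rewrite powR1.
Qed.

(** The factor 2 * 3^d comes from [level_bound], and 2^a from rounding up to the next dyadic level.
    With theta = 2^(a-1), one theta comes from (2h)^(a-1) and theta / (theta - 1) from
    [geometric_below]. *)
Definition embedding_cst (a : R) : R :=
  2 * 3 ^+ d * (2 `^ a * (2 `^ (a - 1) * 2 `^ (a - 1) / (2 `^ (a - 1) - 1))).

Lemma embedding_cst_gt0 (a : R) : 1 < a -> 0 < embedding_cst a.
Proof.
move=> a1; have t1 : 1 < 2 `^ (a - 1) by rewrite two_powR_gt1// subr_gt0.
have d0 : 0 < 2 * 3 ^+ d :> R by rewrite mulr_gt0// exprn_gt0.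
rewrite /embedding_cst mulr_gt0// mulr_gt0 ?powR_gt0//.
by rewrite divr_gt0 ?subr_gt0// mulr_gt0 ?powR_gt0.
Qed.

(** A single term suffices: the one at the last level below z, whose successor level is at least z.
    The assumptions on [t0] and [K] place every positive z between the extreme levels. *)
Lemma level_decomposition (a t0 z : R) K : 0 < a -> 0 < t0 -> 0 <= z ->
  (0 < z -> t0 < z) -> z <= 2 ^+ K * t0 ->
  z `^ a <= \sum_(j < K | 2 ^+ j * t0 < z) (2 ^+ j.+1 * t0) `^ a.
Proof.
move=> a0 t00 z0 zt zK; elim: K zK => [|K IH] zK.
  rewrite expr0 mul1r in zK; have -> : z = 0.
    by apply/eqP; rewrite eq_le z0 andbT leNgt; apply/negP => /zt; rewrite ltNge zK.
  by rewrite powR0 ?gt_eqF// big_ord0.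
rewrite big_mkcond big_ord_recr/= -big_mkcond/=.
have S0 : 0 <= \sum_(j < K | 2 ^+ j * t0 < z) (2 ^+ j.+1 * t0) `^ a.
  by apply: sumr_ge0 => j _; exact: powR_ge0.
case: ifPn => h; last by rewrite addr0 IH// leNgt.
rewrite -[leLHS]add0r lerD//.
by rewrite ge0_ler_powR ?nnegrE ?(ltW a0)// mulr_ge0 ?exprn_ge0// ltW.
Qed.

Section family.
Variables (I : choiceType) (P : I -> cube R d) (E : I -> set (euclid R d)).
Hypothesis P0 : forall i, 0 < side (P i).
Hypothesis mE : forall i, measurable (E i).
Hypothesis EP : forall i, E i `<=` cube_set (P i).

Let mP i : measurable (cube_set (P i)). Proof. exact: measurable_cube. Qed.

Lemma sum_measure_le (s : seq I) (A : set (euclid R d)) :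
  measurable A -> uniq s -> trivIset [set` s] E ->
  (forall i, i \in s -> E i `<=` A) ->
  (\sum_(i <- s) mu (E i) <= mu A)%E.
Proof.
move=> mA us tE EA.
have mU : measurable (\big[setU/set0]_(i <- s) E i) by exact: bigsetU_measurable.
have -> : (\sum_(i <- s) mu (E i) = mu (\big[setU/set0]_(i <- s) E i))%E.
  rewrite -[RHS]mul1e -(integral_cst mu mU 1%E) ge0_integral_bigsetU//.
  by apply: eq_bigr => i _; rewrite (integral_cst mu (mE i) 1%E) mul1e.
apply: le_measure; rewrite ?inE//.
by rewrite -bigcup_seq => x [i /= /EA]; exact.
Qed.

(* Vitali covering: all the cubes meeting a cube of largest side lie in its
   threefold dilation. *)
Lemma weak_type (h : euclid R d -> R) (t : R) (s : seq I) :
  measurable_fun setT h -> (forall x, 0 <= h x) -> 0 <= t ->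
  uniq s -> trivIset [set` s] E ->
  (forall i, i \in s ->
    ((t * vol (P i))%:E <= \int[mu]_(x in cube_set (P i)) (h x)%:E)%E) ->
  (t%:E * \sum_(i <- s) mu (E i) <= (3 ^+ d)%:E *
     \int[mu]_(x in \big[setU/set0]_(i <- s) cube_set (P i)) (h x)%:E)%E.
Proof.
move=> mh h0 t0; have [n] := ubnP (size s); elim: n s => // n IH s sn us tE hs.
have h0E (A : set (euclid R d)) x : A x -> (0 <= (h x)%:E)%E by rewrite lee_fin.
have mhE (A : set (euclid R d)) : measurable_fun A (EFin \o h).
  by apply/measurable_EFinP; exact: measurable_funTS.
have [->|s0] := eqVneq s [::].
  by rewrite !big_nil mule0 integral_set0 mule0.
have [i0 i0s i0max] := seq_argmax (fun i => side (P i)) s0.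
pose meets i := `[< cube_set (P i0) `&` cube_set (P i) !=set0 >].
pose s2 := [seq i <- s | ~~ meets i].
have i0meets : meets i0.
  apply/asboolP; exists (center (P i0)); split=> i; have := P0 i0;
  by move=> ?; apply/andP; split; lra.
have us2 : uniq s2 by rewrite filter_uniq.
have sub2 : {subset s2 <= s} by move=> i; rewrite mem_filter => /andP[].
have IH2 := IH s2 _ us2 (sub_trivIset sub2 tE) (fun i si => hs i (sub2 i si)).
have U2 : measurable (\big[setU/set0]_(i <- s2) cube_set (P i)).
  exact: bigsetU_measurable.
rewrite (bigID meets)/= ge0_muleDr ?sume_ge0// -[X in (t%:E * X + _)%E]big_filter
  -[X in (_ + t%:E * X)%E]big_filter -/s2.
(* The sets E of all cubes meeting P i0 are charged to the integral over P i0. The other cubes are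
   disjoint from P i0, so the induction hypothesis adds an integral over a disjoint region. *)
apply: (@le_trans _ _ ((3 ^+ d)%:E * \int[mu]_(x in cube_set (P i0)) (h x)%:E +
   (3 ^+ d)%:E * \int[mu]_(x in \big[setU/set0]_(i <- s2) cube_set (P i)) (h x)%:E)%E).
  apply: leeD; last first.
    apply: IH2; rewrite (leq_trans _ (ltnSE sn))// size_filter.
    rewrite -(count_predC meets s) -[ltnLHS]add0n ltn_add2r -has_count.
    by apply/hasP; exists i0.
  apply: (@le_trans _ _ (t%:E * ((3 ^+ d) * vol (P i0))%:E)%E).
    apply: lee_wpmul2l; first by rewrite lee_fin.
    have l3 : 0 <= side (dilate 3 (P i0)) by rewrite mulr_ge0// ltW.
    rewrite -vol_dilate// ?(ltW (P0 _))// -(lebesgue_cubeE l3).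
    apply: sum_measure_le.
    - exact: measurable_cube.
    - by rewrite filter_uniq.
    - by apply: sub_trivIset tE => i /=; rewrite mem_filter => /andP[].
    - move=> i; rewrite mem_filter => /andP[/asboolP im si] x Ex.
      apply: (cube_set_meet (P0 i0) (i0max _ si) im); exact: EP.
  rewrite EFinM muleCA; apply: lee_wpmul2l; first by rewrite lee_fin exprn_ge0.
  by rewrite -EFinM; exact: hs.
have I0 (A : set (euclid R d)) : (0 <= \int[mu]_(x in A) (h x)%:E)%E.
  by apply: integral_ge0 => x; exact: h0E.
rewrite -ge0_muleDr//; apply: lee_wpmul2l.
  by rewrite lee_fin exprn_ge0.
rewrite -ge0_integral_setU//; last 2 first.
- exact: h0E.
- rewrite disj_set2E; apply/eqP; rewrite -bigcup_seq setI_bigcupr.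
  apply: bigcup0 => i /=; rewrite mem_filter => /andP[/negP im _].
  have [//|/set0P ne] := eqVneq (cube_set (P i0) `&` cube_set (P i)) set0.
  by case: im; exact/asboolP.
apply: ge0_subset_integral => //.
- exact: measurableU.
- exact: bigsetU_measurable.
- exact: h0E.
- rewrite -!bigcup_seq => x [Px|[i /= /sub2 ? ?]]; by [exists i0|exists i].
Qed.

Variables (h : euclid R d -> R) (y : I -> R) (s : seq I).
Hypotheses (mh : measurable_fun setT h) (h0 : forall x, 0 <= h x).
Hypotheses (us : uniq s) (tE : trivIset [set` s] E).
Hypothesis y0 : forall i, i \in s -> 0 <= y i.
Hypothesis hy : forall i, i \in s ->
  ((y i * vol (P i))%:E <= \int[mu]_(x in cube_set (P i)) (h x)%:E)%E.

(** The truncation of Marcinkiewicz interpolation: at a given point only levels below 2h survive,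
    which makes the weak type bounds summable over the levels. *)
Let hcut (tau : R) (x : euclid R d) : R := h x * \1_[set x | tau / 2 < h x] x.

Let hcut_ge0 tau x : 0 <= hcut tau x.
Proof. by rewrite mulr_ge0. Qed.

Let measurable_hcut tau : measurable_fun setT (hcut tau).
Proof.
apply: measurable_funM => //; apply: measurable_indic.
rewrite (_ : [set _ | _] = setT `&` h @^-1` `]tau / 2, +oo[%classic); last first.
  by apply/seteqP; split=> x /=; rewrite in_itv/= andbT// => -[].
exact: mh.
Qed.

(** Since h <= tau / 2 + [hcut tau], a cube where the average of h is at least y i > tau keeps an
    average of at least tau / 2 after truncation. The weak type inequality at height tau / 2 yields
    the extra factor 2. *)
Lemma level_bound (tau : R) : 0 < tau ->
  (tau%:E * \sum_(i <- s | (tau < y i)%R) mu (E i) <=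
   (2 * 3 ^+ d)%:E * \int[mu]_x (hcut tau x)%:E)%E.
Proof.
move=> tau0; rewrite -big_filter; set s' := [seq _ <- _ | _].
have ss : {subset s' <= s} by move=> i; rewrite mem_filter => /andP[].
have m0 : (0 <= \sum_(i <- s') mu (E i))%E by exact: sume_ge0.
have -> : (tau%:E * \sum_(i <- s') mu (E i) =
   2%:E * ((tau / 2)%:E * \sum_(i <- s') mu (E i)))%E.
  by rewrite muleA -EFinM mulrC divfK.
rewrite (EFinM 2) -muleA; apply: lee_wpmul2l => //.
have mhE (A : set (euclid R d)) : measurable_fun A (EFin \o hcut tau).
  by apply/measurable_EFinP; exact: measurable_funTS.
apply: (le_trans (weak_type (t := tau / 2) (h := hcut tau) _ _ _ _ _ _)) => //.
- by rewrite divr_ge0// ltW.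
- by rewrite filter_uniq.
- exact: sub_trivIset tE.
- move=> i; rewrite mem_filter => /andP[taui si].
  have li := ltW (P0 i); have vi := ltW (vol_gt0 (P0 i)).
  rewrite -(@leeD2rE _ (tau / 2 * vol (P i))%:E)// -EFinD.
  have -> : tau / 2 * vol (P i) + tau / 2 * vol (P i) = tau * vol (P i) by lra.
  apply: (@le_trans _ _ (y i * vol (P i))%:E); first by rewrite lee_fin ler_wpM2r// ltW.
  apply: (le_trans (hy si)).
  rewrite [in leRHS]EFinM -(lebesgue_cubeE li) -(integral_cst mu (mP i) (tau / 2)%:E).
  have p1 : (0 <= (tau / 2)%:E)%E by rewrite lee_fin divr_ge0// ltW.
  have p2 x : cube_set (P i) x -> (0 <= (hcut tau x)%:E)%E by rewrite lee_fin.
  rewrite -ge0_integralD//.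
  apply: ge0_le_integral => //.
  + by move=> x _; rewrite lee_fin.
  + by apply/measurable_EFinP; exact: measurable_funTS.
  + by apply: emeasurable_funD => //; exact: measurable_cst.
  + move=> x _; rewrite lee_fin /hcut indicE.
    have [hx|hx] := ltP (tau / 2) (h x).
      by rewrite mem_set// mulr1 lerDl divr_ge0// ltW.
    by rewrite memNset ?mulr0 ?add0r//=; apply/negP; rewrite -leNgt.
apply: lee_wpmul2l; first by rewrite lee_fin exprn_ge0.
apply: ge0_subset_integral => //; first exact: bigsetU_measurable.
by move=> x _; rewrite lee_fin.
Qed.

(** Marcinkiewicz interpolation over dyadic levels: each power of y i is split into levels, each
    level is bounded by the weak type estimate, and the sum over levels is performed pointwise under
    the integral. *)
Lemma carleson_embedding (a : R) : 1 < a ->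
  (\sum_(i <- s) mu (E i) * (y i `^ a)%:E <=
   (embedding_cst a)%:E * \int[mu]_x (h x `^ a)%:E)%E.
Proof.
move=> a1.
(* The family is finite, so finitely many dyadic levels between [t0] and 2^K * [t0] see every
   positive y i; the final bound involves neither [t0] nor K. *)
have [t0 t00 yt] : exists2 t0 : R, 0 < t0 & forall i, i \in s -> 0 < y i -> t0 < y i.
  elim: s => [|i s' [t0 t00 IH]]; first by exists 1.
  have [yi|yi] := ltP 0 (y i); last first.
    exists t0 => // j; rewrite inE => /predU1P[->|/IH//]; by rewrite ltNge yi.
  exists (Num.min t0 (y i) / 2); first by rewrite divr_gt0// lt_min t00.
  have mt : Num.min t0 (y i) / 2 < Num.min t0 (y i).
    by rewrite ltr_pdivrMr// ltr_pMr ?lt_min ?t00// ltr1n.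
  move=> j; rewrite inE => /predU1P[->|/IH/[apply] ty] //.
    by move=> _; rewrite (lt_le_trans mt)// ge_min lexx orbT.
  by rewrite (lt_trans mt)// gt_min ty.
have [K yK] : exists K, forall i, i \in s -> y i <= 2 ^+ K * t0.
  elim: s => [|i s' [K IH]]; first by exists 0.
  exists (maxn K (Num.truncn (y i / t0)).+1) => j.
  have mono m n : (m <= n)%N -> 2 ^+ m * t0 <= 2 ^+ n * t0.
    by move=> mn; rewrite ler_pM2r// ler_eXn2l// ltr1n.
  rewrite inE => /predU1P[->|/IH/le_trans]; last first.
    by apply; apply: mono; exact: leq_maxl.
  apply: (@le_trans _ _ (2 ^+ (Num.truncn (y i / t0)).+1 * t0)); last first.
    by apply: mono; exact: leq_maxr.
  rewrite -ler_pdivrMr// (le_trans (ltW (truncnS_gt _)))//.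
  by rewrite -natrX ler_nat ltnW// ltn_expl.
pose tau j : R := 2 ^+ j * t0.
have tau0 j : 0 < tau j by rewrite mulr_gt0// exprn_gt0.
have a0 : 0 < a by lra.
(* What remains of [tau j.+1] to the power a after splitting off the factor [tau j] consumed by
   [level_bound]. *)
pose c j := 2 `^ a * tau j `^ (a - 1).
have c0 j : 0 <= c j by rewrite mulr_ge0 ?powR_ge0.
have ctau j : tau j.+1 `^ a = c j * tau j.
  rewrite /tau exprS -mulrA powRM ?(ltW (tau0 _))// /c -/(tau j) -mulrA.
  by rewrite (mulrC _ (tau j)) mulr_powRB1// ltW.
have m0 i : (0 <= mu (E i))%E by [].
apply: (@le_trans _ _ (\sum_(i <- s)
    \sum_(j < K | (tau j < y i)%R) (tau j.+1 `^ a)%:E * mu (E i))%E).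
  rewrite big_seq [leRHS]big_seq; apply: lee_sum => i si.
  rewrite -ge0_sume_distrl; last by move=> j _; rewrite lee_fin powR_ge0.
  rewrite muleC; apply: lee_wpmul2r => //; rewrite sumEFin lee_fin.
  by apply: level_decomposition => //; [exact: y0|exact: yt|exact: yK].
rewrite (exchange_big_dep xpredT)//=.
apply: (@le_trans _ _ (\sum_(j < K) (c j)%:E *
    ((2 * 3 ^+ d)%:E * \int[mu]_x (hcut (tau j) x)%:E))%E).
  apply: lee_sum => j _; rewrite -ge0_sume_distrr//.
  rewrite ctau (EFinM (c j)) -muleA; apply: lee_wpmul2l; first by rewrite lee_fin.
  exact: level_bound.
have mcut j : measurable_fun setT (EFin \o hcut (tau j)).
  by apply/measurable_EFinP; exact: measurable_hcut.
have cut0 j x : (0 <= (hcut (tau j) x)%:E)%E by rewrite lee_fin.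
have d3 : 0 <= 2 * 3 ^+ d :> R by rewrite mulr_ge0 ?exprn_ge0.
have -> : (\sum_(j < K) (c j)%:E *
     ((2 * 3 ^+ d)%:E * \int[mu]_x (hcut (tau j) x)%:E) =
   (2 * 3 ^+ d)%:E * \int[mu]_x (\sum_(j < K) (c j * hcut (tau j) x)%:E))%E.
  rewrite ge0_integral_sum//; last 2 first.
  - by move=> j; apply/measurable_EFinP; exact: measurable_funM.
  - by move=> j x _; rewrite lee_fin mulr_ge0.
  rewrite ge0_sume_distrr; last first.
    by move=> j _; apply: integral_ge0 => x _; rewrite lee_fin mulr_ge0.
  apply: eq_bigr => j _; rewrite muleCA; congr (_ * _)%E.
  under [in RHS]eq_integral do rewrite EFinM.
  by rewrite ge0_integralZl//; [exact: mcut|rewrite lee_fin].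
rewrite /embedding_cst (EFinM (2 * 3 ^+ d)) -muleA; apply: lee_wpmul2l.
  by rewrite lee_fin.
set theta := 2 `^ (a - 1).
have theta1 : 1 < theta by rewrite two_powR_gt1// subr_gt0.
set kappa := 2 `^ a * _.
have kappa0 : 0 <= kappa.
  by rewrite mulr_ge0 ?powR_ge0// divr_ge0 ?mulr_ge0//; lra.
have mha : measurable_fun setT (fun x => h x `^ a).
  exact: (measurableT_comp (measurable_powR a)).
rewrite -ge0_integralZl//; last 2 first.
- exact/measurable_EFinP.
- by move=> x _; rewrite lee_fin powR_ge0.
apply: ge0_le_integral => //.
- by move=> x _; rewrite sumEFin lee_fin; apply: sumr_ge0 => j _; rewrite mulr_ge0.
- apply: emeasurable_sum => j; apply/measurable_EFinP; exact: measurable_funM.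
- by apply/measurable_EFinP; exact: measurable_funM.
move=> x _; rewrite sumEFin -EFinM lee_fin.
(* At a fixed x the surviving levels satisfy tau j < 2 h(x), and their powers a - 1 form a geometric
   progression of ratio theta > 1. *)
have -> : \sum_(j < K) c j * hcut (tau j) x =
    2 `^ a * (h x * \sum_(j < K | tau j / 2 < h x) tau j `^ (a - 1)).
  rewrite [in RHS]big_mkcond !mulr_sumr; apply: eq_bigr => j _.
  rewrite /c /hcut indicE -mulrA; congr (_ * _); rewrite mulrCA; congr (_ * _).
  have [hx|hx] := ltP (tau j / 2) (h x).
    by rewrite mem_set// mulr1.
  by rewrite memNset ?mulr0//=; apply/negP; rewrite -leNgt.
rewrite /kappa -(mulrA (2 `^ a)) ler_wpM2l ?powR_ge0//.
rewrite -(mulr_powRB1 (h0 x) a0) [leRHS]mulrCA ler_wpM2l//.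
pose Z := (2 * h x) `^ (a - 1).
have am : 0 < a - 1 by lra.
have tauE j : tau j `^ (a - 1) = t0 `^ (a - 1) * theta ^+ j.
  rewrite /tau powRM ?exprn_ge0 ?(ltW t00)// mulrC; congr (_ * _).
  by rewrite -(powR_mulrn j (ler0n R 2)) -powRrM mulrC powRrM powR_mulrn// powR_ge0.
apply: (@le_trans _ _ (Z * theta / (theta - 1))); last first.
  by rewrite /Z powRM// -/theta; lra.
apply: le_trans (geometric_below K theta1 (powR_gt0 (a - 1) t00) (powR_ge0 _ _)).
rewrite big_mkcond [leRHS]big_mkcond; apply: ler_sum => j _.
rewrite -tauE; case: ifPn => hj; last by case: ifPn => // _; exact: powR_ge0.
rewrite ifT// gt0_ltr_powR ?nnegrE ?(ltW (tau0 _)) ?mulr_ge0//.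
by move: hj; rewrite ltr_pdivrMr// mulrC.
Qed.

End family.
End carleson_embedding.
Arguments embedding_cst {R} d a.

(** * The kernel *)

Section power_inequalities.
Context {R : realType}.
Implicit Types x y z s u v a b : R.

(** For t = x and t = y one has t <= t^s (x + y)^(1-s); add the two and divide by (x + y)^(1-s). *)
Lemma powR_subadditive s x y : 0 <= s <= 1 -> 0 <= x -> 0 <= y ->
  (x + y) `^ s <= x `^ s + y `^ s.
Proof.
move=> /andP[s0 s1]; wlog : x y / x <= y => [wl x0 y0|xy x0 y0].
  have [xy|/ltW yx] := leP x y; first exact: wl.
  by rewrite addrC [leRHS]addrC; exact: wl.
have [yE|yn0] := eqVneq y 0.
  have -> : x = 0 by apply/eqP; rewrite eq_le x0 andbT -yE.
  by rewrite yE addr0 lerDl powR_ge0.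
have z0 : 0 < x + y by rewrite ltr_wpDl// lt_neqAle eq_sym yn0.
have part t : 0 <= t -> t <= x + y -> t <= t `^ s * (x + y) `^ (1 - s).
  move=> t0 tz; have [->|tn0] := eqVneq t 0.
    by rewrite mulr_ge0 ?powR_ge0.
  rewrite -[leLHS]powRr1// -[X in t `^ X](subrKC s) powRD ?tn0 ?implybT//.
  by rewrite ler_wpM2l ?powR_ge0// ge0_ler_powR ?nnegrE ?subr_ge0// ltW.
have := lerD (part x x0 _) (part y y0 _); rewrite lerDl lerDr => /(_ y0 x0).
rewrite -mulrDl -{1}(powRr1 (ltW z0)) -{1}(subrKC s 1) powRD; last first.
  by rewrite (gt_eqF z0) implybT.
by rewrite ler_pM2r// powR_gt0.
Qed.

(** By symmetry a <= b and v <= u, and by homogeneity v = u t with t <= 1. The claim becomes t^a (1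
    - t^(b-a)) <= 1 - t <= (1 - t)^(a+b), as b - a and a + b are at most 1. *)
Lemma power_kernel_le a b u v : 0 <= a -> 0 <= b -> a + b <= 1 ->
  0 <= u -> 0 <= v ->
  `|u `^ b * v `^ a - u `^ a * v `^ b| <= `|u - v| `^ (a + b).
Proof.
wlog ab : a b / a <= b => [wl a0 b0 ab1 u0 v0|].
  have [ab|/ltW ba] := leP a b; first exact: wl.
  by rewrite distrC (addrC a); apply: wl => //; rewrite addrC.
move=> a0 b0 ab1; wlog vu : u v / v <= u => [wl u0 v0|u0 v0].
  have [vu|/ltW uv] := leP v u; first exact: wl.
  rewrite distrC (distrC u) (mulrC (u `^ a)) (mulrC (u `^ b)).
  exact: wl.
(* Here 0^0 = 1 matters: for a = 0 < b and v = 0 the left-hand side is u^b, and equality holds. *)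
have [->|vn0] := eqVneq v 0.
  have [->|an0] := eqVneq a 0.
    rewrite !powRr0 mulr1 add0r subr0 mul1r.
    have [->|bn0] := eqVneq b 0; first by rewrite !powRr0 subrr normr0 ler01.
    by rewrite powR0// subr0 ger0_norm ?powR_ge0// ger0_norm.
  have bn0 : b != 0 by rewrite gt_eqF// (lt_le_trans _ ab)// lt0r an0.
  by rewrite !powR0// !mulr0 subrr normr0 powR_ge0.
have vp : 0 < v by rewrite lt0r vn0.
have up : 0 < u by exact: lt_le_trans vu.
pose t := v / u; have tp : 0 < t by rewrite divr_gt0.
have t1 : t <= 1 by rewrite ler_pdivrMr// mul1r.
have vE : v = u * t by rewrite mulrC divfK// gt_eqF.
clearbody t.
have pE k l : u `^ k * (u * t) `^ l = u `^ (k + l) * t `^ l.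
  by rewrite powRM ?(ltW tp)// ?(ltW up)// mulrA powRD// (gt_eqF up) implybT.
rewrite vE !pE (addrC b) -mulrBr normrM ger0_norm ?powR_ge0//.
have -> : u - u * t = u * (1 - t) by rewrite mulrBr mulr1.
rewrite normrM powRM ?normr_ge0// (gtr0_norm up) ler_pM2l ?powR_gt0//.
have tab : t `^ b = t `^ a * t `^ (b - a).
  by rewrite -powRD ?subrKC// (gt_eqF tp) implybT.
have ta1 : t `^ a <= 1 by rewrite -(powRr0 t) ger_powR ?tp.
have tba : t <= t `^ (b - a) by rewrite ger1_powR ?tp// lerBlDr; lra.
have tba1 : t `^ (b - a) <= 1 by rewrite -[leRHS](powRr0 t) ger_powR ?tp// subr_ge0.
rewrite tab -{1}[t `^ a]mulr1 -mulrBr ger0_norm; last first.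
  by rewrite mulr_ge0 ?powR_ge0// subr_ge0.
have d0 : 0 <= 1 - t by rewrite subr_ge0.
apply: (@le_trans _ _ (1 - t)).
  rewrite -[leRHS]mul1r ler_pM ?powR_ge0 ?subr_ge0//; lra.
rewrite (ger0_norm d0); have [->|tn1] := eqVneq (1 - t) 0; first exact: powR_ge0.
by rewrite ger1_powR// lt0r tn1 d0/=; lra.
Qed.

(** A passage to the limit, with content only at x0 = 0: a positive z is refuted by x = z / (2k). It
    later lowers positive majorants to norms that may vanish. *)
Lemma le_mul_closure k x0 z : 0 <= x0 ->
  (forall x, 0 < x -> x0 <= x -> z <= k * x) -> z <= k * x0.
Proof.
move=> x00 h; have [xp|] := ltP 0 x0; first exact: h.
move=> xn; have x0E : x0 = 0 by apply/eqP; rewrite eq_le xn.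
rewrite x0E mulr0 leNgt; apply/negP => z0.
have := h 1 ltr01; rewrite x0E mulr1 ler01 => /(_ isT) zk.
have k0 : 0 < k by exact: lt_le_trans zk.
have := h (z / 2 / k); rewrite x0E !divr_gt0// => /(_ isT).
rewrite ltW ?divr_gt0// => /(_ isT); rewrite mulrC divfK ?gt_eqF//; lra.
Qed.

End power_inequalities.

(** * Averages and pairings of convex bodies *)

Section averages.
Context {R : realType} {d : nat}.
Local Notation mu := (lebesgue R d).
Implicit Types (Q : cube R d) (h : euclid R d -> R).

Lemma average_le Q h (k : R) : 0 < side Q -> (forall x, 0 <= h x) ->
  (\int[mu]_(x in cube_set Q) (h x)%:E <= (k * vol Q)%:E)%E -> average Q h <= k.
Proof.
move=> l0 h0 hk; have v0 := vol_gt0 l0.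
have I0 : (0 <= \int[mu]_(x in cube_set Q) (h x)%:E)%E.
  by apply: integral_ge0 => x _; rewrite lee_fin.
rewrite /average mulrC ler_pdivrMr// -lee_fin /Rintegral fineK//.
by rewrite ge0_fin_numE// (le_lt_trans hk)// ltry.
Qed.

Lemma averageE Q h : 0 < side Q -> (forall x, 0 <= h x) ->
  (\int[mu]_(x in cube_set Q) (h x)%:E < +oo)%E ->
  (\int[mu]_(x in cube_set Q) (h x)%:E = (average Q h * vol Q)%:E)%E.
Proof.
move=> l0 h0 hk; have v0 := vol_gt0 l0.
have I0 : (0 <= \int[mu]_(x in cube_set Q) (h x)%:E)%E.
  by apply: integral_ge0 => x _; rewrite lee_fin.
rewrite /average mulrC mulVKf ?gt_eqF// /Rintegral fineK//.
by rewrite ge0_fin_numE.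
Qed.

Lemma average_ge0 Q h : 0 < side Q -> (forall x, 0 <= h x) -> 0 <= average Q h.
Proof.
move=> l0 h0; rewrite /average mulr_ge0// ?invr_ge0 ?(ltW (vol_gt0 l0))//.
by apply: fine_ge0; apply: integral_ge0 => x _; rewrite lee_fin.
Qed.

End averages.

Section convex_body_pairing.
Context {R : realType} {d : nat}.
Local Notation mu := (lebesgue R d).
Local Notation func := (euclid R d -> R).
Variable Q : cube R d.
Hypothesis l0 : 0 < side Q.
Local Notation L1 := (carrier (L1_normalized Q)).

Let mQ := measurable_cube Q.

Lemma L1_comb (k : R) (u v : func) : L1 u -> L1 v -> L1 (k *: u + v).
Proof.
rewrite /= => iu iv.
rewrite (_ : _ \o _ = (fun x => k%:E * (EFin \o u) x + (EFin \o v) x)%E).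
  by apply: integrableD => //; exact: integrableZl.
by apply/funext => x /=; rewrite EFinD EFinM.
Qed.

Lemma L1_0 : L1 (0 : func).
Proof. by rewrite /=; exact: integrable0. Qed.

(** The trailing 0 fits the shape [a *: u + v] in which [linear_on] expresses linearity. *)
Lemma dual_ball_comb (phi : func -> R) (k l : R) (u v : func) :
  dual_ball (L1_normalized Q) phi -> L1 u -> L1 v ->
  k * phi u + l * phi v = phi (k *: u + (l *: v + 0)).
Proof.
move=> [lphi _] Lu Lv; have L0 := L1_0.
have phi0 : phi 0 = 0.
  by have := lphi 1 0 0 L0 L0; rewrite scaler0 addr0 mul1r; lra.
rewrite !lphi// ?phi0 ?addr0// -[X in L1 X]addr0; exact: L1_comb.
Qed.

Lemma dual_ball_comb_le (phi : func -> R) (k l : R) (u v : func) :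
  dual_ball (L1_normalized Q) phi -> L1 u -> L1 v ->
  `|k * phi u + l * phi v| <= average Q (fun x => `|k * u x + l * v x|).
Proof.
move=> phiB Lu Lv; rewrite (dual_ball_comb k l phiB Lu Lv).
have [_ /(_ (k *: u + (l *: v + 0)))] := phiB => /=.
have -> : (fun x => `|(k *: u + (l *: v + 0)) x|) = (fun x => `|k * u x + l * v x|).
  by apply/funext => x; rewrite /= addr0.
apply; apply: L1_comb => //; apply: L1_comb => //; exact: L1_0.
Qed.

(* The left-hand side is [phi] applied to
   [x |-> f x * psi (y |-> g y * (b x `^ beta * b y `^ alpha - ...))], so that [phi]
   and [psi] need not be represented by functions. *)
Lemma pairing_le (b f g : func) (alpha beta c p u v w : R) (phi psi : func -> R) :
  (forall x, 0 <= b x) -> 0 <= alpha -> 0 <= beta -> alpha + beta <= 1 ->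
  measurable_fun setT b -> measurable_fun setT f -> measurable_fun setT g ->
  L1 (powmul b beta f) -> L1 (powmul b alpha f) ->
  L1 (powmul b beta g) -> L1 (powmul b alpha g) ->
  0 <= v -> 0 <= w ->
  (\int[mu]_(x in cube_set Q) (`|b x - c| `^ (alpha + beta) * `|f x|)%:E
     <= (p * vol Q)%:E)%E ->
  (\int[mu]_(x in cube_set Q) `|f x|%:E <= (u * vol Q)%:E)%E ->
  (\int[mu]_(x in cube_set Q) `|g x|%:E <= (v * vol Q)%:E)%E ->
  (\int[mu]_(x in cube_set Q) (`|b x - c| `^ (alpha + beta) * `|g x|)%:E
     <= (w * vol Q)%:E)%E ->
  dual_ball (L1_normalized Q) phi -> dual_ball (L1_normalized Q) psi ->
  phi (powmul b beta f) * psi (powmul b alpha g) -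
  phi (powmul b alpha f) * psi (powmul b beta g) <= p * v + u * w.
Proof.
move=> b0 a0 be0 ab1 mb mf mg Lbf Laf Lbg Lag v0 w0 hp hu hv hw phiB psiB.
set s := alpha + beta in hp hw *.
have s01 : 0 <= s <= 1 by rewrite addr_ge0.
have mpow k : measurable_fun setT (fun x => b x `^ k).
  exact: (measurableT_comp (measurable_powR k)).
have mdist : measurable_fun setT (fun x => `|b x - c| `^ s).
  apply: (measurableT_comp (measurable_powR s)); apply: measurableT_comp => //.
  by apply: measurable_funB => //; exact: measurable_cst.
have mnf : measurable_fun setT (fun x => `|f x|) by exact: measurableT_comp.
have mng : measurable_fun setT (fun x => `|g x|) by exact: measurableT_comp.
(* For fixed x the powers of b x are scalars, so psi acts on a single function of y: the kernel
   times g. *)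
have inner x : `|b x `^ beta * psi (powmul b alpha g) +
     - b x `^ alpha * psi (powmul b beta g)| <= `|b x - c| `^ s * v + w.
  apply: (le_trans (dual_ball_comb_le _ _ psiB Lag Lbg)).
  apply: average_le => //.
  apply: (@le_trans _ _ (\int[mu]_(y in cube_set Q)
      ((`|b x - c| `^ s)%:E * `|g y|%:E + (`|b y - c| `^ s * `|g y|)%:E))%E).
    apply: ge0_le_integral => //.
    - apply/measurable_EFinP; apply: measurable_funTS; apply: measurableT_comp => //.
      rewrite /powmul; apply: measurable_funD; apply: measurable_funM => //;
      by apply: measurable_funM.
    - apply/measurable_EFinP; apply: measurable_funTS; apply: measurable_funD;
      by apply: measurable_funM.
    - move=> y _; rewrite -EFinM -EFinD lee_fin /powmul.
      have -> : b x `^ beta * (b y `^ alpha * g y) + - b x `^ alpha * (b y `^ beta * g y)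
         = (b x `^ beta * b y `^ alpha - b x `^ alpha * b y `^ beta) * g y by lra.
      rewrite normrM -mulrDl ler_wpM2r//.
      apply: (le_trans (power_kernel_le a0 be0 ab1 (b0 x) (b0 y))).
      rewrite -/s (le_trans _ (powR_subadditive s01 _ _))//.
      have := s01 => /andP[s0 _]; rewrite ge0_ler_powR// ?nnegrE ?addr_ge0//.
      by rewrite (distrC (b y)) (le_trans _ (ler_normD _ _))// addrA subrK.
  rewrite ge0_integralD//; last 2 first.
  - by apply/measurable_EFinP; apply: measurable_funTS; exact: measurable_funM.
  - by apply/measurable_EFinP; apply: measurable_funTS; exact: measurable_funM.
  rewrite ge0_integralZl//; last by apply/measurable_EFinP; exact: measurable_funTS.
  rewrite mulrDl EFinD; apply: leeD => //.
  by rewrite -mulrA EFinM; apply: lee_wpmul2l => //; rewrite lee_fin powR_ge0.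
(* Now the two values of psi are the scalars, and phi acts on f times the quantity bounded by
   [inner]. *)
have -> : phi (powmul b beta f) * psi (powmul b alpha g) -
    phi (powmul b alpha f) * psi (powmul b beta g) =
  psi (powmul b alpha g) * phi (powmul b beta f) +
    - psi (powmul b beta g) * phi (powmul b alpha f) by lra.
apply: (le_trans (ler_norm _)).
apply: (le_trans (dual_ball_comb_le _ _ phiB Lbf Laf)).
apply: average_le => //.
apply: (@le_trans _ _ (\int[mu]_(x in cube_set Q)
    (v%:E * (`|b x - c| `^ s * `|f x|)%:E + w%:E * `|f x|%:E))%E).
  apply: ge0_le_integral => //.
  - apply/measurable_EFinP; apply: measurable_funTS; apply: measurableT_comp => //.
    rewrite /powmul; apply: measurable_funD; apply: measurable_funM => //;
    by apply: measurable_funM.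
  - apply/measurable_EFinP; apply: measurable_funTS; apply: measurable_funD;
    apply: measurable_funM => //; exact: measurable_funM.
  - move=> x _; rewrite -!EFinM -EFinD lee_fin /powmul.
    have -> : psi (fun x0 => b x0 `^ alpha * g x0) * (b x `^ beta * f x) +
       - psi (fun x0 => b x0 `^ beta * g x0) * (b x `^ alpha * f x) =
      (b x `^ beta * psi (powmul b alpha g) +
       - b x `^ alpha * psi (powmul b beta g)) * f x by rewrite /powmul; lra.
    rewrite normrM; apply: (le_trans (ler_wpM2r (normr_ge0 _) (inner x))).
    by rewrite mulrDl mulrCA mulrA.
rewrite ge0_integralD//; last 4 first.
- by move=> y _; rewrite -EFinM lee_fin !mulr_ge0 ?powR_ge0.
- apply/measurable_EFinP; apply: measurable_funTS; apply: measurable_funM => //.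
  exact: measurable_funM.
- by move=> y _; rewrite -EFinM lee_fin mulr_ge0.
- by apply/measurable_EFinP; apply: measurable_funTS; exact: measurable_funM.
rewrite ge0_integralZl//; last first.
  by apply/measurable_EFinP; apply: measurable_funTS; exact: measurable_funM.
rewrite ge0_integralZl//; last by apply/measurable_EFinP; exact: measurable_funTS.
rewrite mulrDl EFinD; apply: leeD.
  by rewrite mulrAC mulrC EFinM; apply: lee_wpmul2l => //; rewrite lee_fin.
by rewrite mulrAC mulrC EFinM; apply: lee_wpmul2l => //; rewrite lee_fin.
Qed.

End convex_body_pairing.

(** * Power means *)

Section power_means.
Context {R : realType} {d : nat}.
Local Notation mu := (lebesgue R d).
Implicit Types (Q : cube R d) (f g : euclid R d -> R).

Definition power_mean (r : R) f Q : R :=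
  average Q (fun x => `|f x| `^ r) `^ r^-1.

Lemma power_mean_ge0 r f Q : 0 <= power_mean r f Q.
Proof. exact: powR_ge0. Qed.

Lemma measurable_abs_powR (r : R) f : measurable_fun setT f ->
  measurable_fun setT (fun x => `|f x| `^ r).
Proof.
by move=> mf; apply: (measurableT_comp (measurable_powR r)); exact: measurableT_comp.
Qed.

(** On a set of finite measure, t^r <= 1 + t^p is enough. *)
Lemma power_integral_lty (r p : R) f Q : 0 <= r <= p -> measurable_fun setT f ->
  0 < side Q -> (\int[mu]_x (`|f x| `^ p)%:E < +oo)%E ->
  (\int[mu]_(x in cube_set Q) (`|f x| `^ r)%:E < +oo)%E.
Proof.
move=> /andP[r0 rp] mf l0 fp; have mQ := measurable_cube Q.
have mr := measurable_abs_powR r mf; have mp := measurable_abs_powR p mf.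
apply: (@le_lt_trans _ _ (\int[mu]_(x in cube_set Q) (1%:E + (`|f x| `^ p)%:E))%E).
  apply: ge0_le_integral => //.
  - by apply/measurable_EFinP; exact: measurable_funTS.
  - by apply/measurable_EFinP; apply: measurable_funTS; exact: measurable_funD.
  - move=> x _; rewrite -EFinD lee_fin; have [h|h] := leP `|f x| 1.
      have : `|f x| `^ r <= 1 `^ r by rewrite ge0_ler_powR// nnegrE.
      by rewrite powR1 => /le_trans; apply; rewrite lerDl powR_ge0.
    by rewrite (@le_trans _ _ (`|f x| `^ p))// ?lerDr// ler_powR// ltW.
rewrite ge0_integralD//; last by apply/measurable_EFinP; exact: measurable_funTS.
rewrite (integral_cst mu mQ 1%E) mul1e lte_add_pinfty//.
  exact: lebesgue_cube_lty (ltW l0).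
apply: le_lt_trans fp; apply: ge0_subset_integral => //.
by apply/measurable_EFinP.
Qed.

Lemma power_mean_integral (r p : R) f Q : 0 < r <= p -> measurable_fun setT f ->
  0 < side Q -> (\int[mu]_x (`|f x| `^ p)%:E < +oo)%E ->
  (\int[mu]_(x in cube_set Q) (`|f x| `^ r)%:E = (power_mean r f Q `^ r * vol Q)%:E)%E.
Proof.
move=> /andP[r0 rp] mf l0 fp; rewrite averageE//; last first.
  by apply: power_integral_lty fp => //; rewrite (ltW r0).
rewrite /power_mean -powRrM mulVf ?gt_eqF// powRr1//.
by rewrite average_ge0// => x; exact: powR_ge0.
Qed.

Section family.
Variables (I : choiceType) (P : I -> cube R d) (E : I -> set (euclid R d)).
Hypothesis P0 : forall i, 0 < side (P i).
Hypothesis mE : forall i, measurable (E i).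
Hypothesis EP : forall i, E i `<=` cube_set (P i).
Variable s : seq I.
Hypotheses (us : uniq s) (tE : trivIset [set` s] E).

Lemma measure_piece i : mu (E i) = (fine (mu (E i)))%:E.
Proof.
rewrite fineK// ge0_fin_numE// (@le_lt_trans _ _ (mu (cube_set (P i))))//.
  by apply: le_measure; rewrite ?inE//; exact: measurable_cube.
exact: lebesgue_cube_lty (ltW (P0 i)).
Qed.

(** The embedding is applied to |f|^r with exponent p / r > 1. Dividing by X leaves a pure constant
    on the right, ready for Young's inequality. *)
Lemma power_mean_embedding (r p X : R) f : 0 < r -> r < p -> 0 < X ->
  measurable_fun setT f -> (\int[mu]_x (`|f x| `^ p)%:E <= (X `^ p)%:E)%E ->
  \sum_(i <- s) fine (mu (E i)) * (power_mean r f (P i) / X) `^ p <=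
  embedding_cst d (p / r).
Proof.
move=> r0 rp X0 mf fX; have fp := le_lt_trans fX (ltry _).
have p0 : 0 < p by exact: lt_trans rp.
have a1 : 1 < p / r by rewrite ltr_pdivlMr// mul1r.
pose y i := average (P i) (fun x => `|f x| `^ r).
have y0 i : 0 <= y i by apply: average_ge0 => // x; exact: powR_ge0.
have pmE i : power_mean r f (P i) `^ p = y i `^ (p / r).
  by rewrite /power_mean -/(y i) -powRrM mulrC.
have := @carleson_embedding R d I P E P0 mE EP (fun x => `|f x| `^ r) y s
  (measurable_abs_powR r mf) (fun x => powR_ge0 _ _) us tE (fun i _ => y0 i) _ _ a1.
have hy i : i \in s -> ((y i * vol (P i))%:E <=
    \int[mu]_(x in cube_set (P i)) (`|f x| `^ r)%:E)%E.
  move=> _; rewrite (averageE (P0 i))//.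
  by apply: power_integral_lty fp => //; rewrite (ltW r0) ltW.
move=> /(_ hy).
have -> : (\int[mu]_x (`|f x| `^ r `^ (p / r))%:E = \int[mu]_x (`|f x| `^ p)%:E)%E.
  by apply: eq_integral => x _; rewrite -powRrM mulrC divfK// gt_eqF.
under eq_bigr do rewrite measure_piece -EFinM -pmE.
rewrite sumEFin => emb.
have C0 := ltW (@embedding_cst_gt0 R d _ a1).
have Xp : 0 < X `^ p by rewrite powR_gt0.
rewrite -(ler_pM2r Xp) -lee_fin.
apply: (@le_trans _ _ ((embedding_cst d (p / r))%:E *
    \int[mu]_x (`|f x| `^ p)%:E)%E); last first.
  by rewrite [leRHS]EFinM; apply: lee_wpmul2l => //; rewrite lee_fin.
apply: le_trans emb; rewrite lee_fin mulr_suml; apply: ler_sum => i _.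
rewrite -mulrA -powRM ?divr_ge0 ?power_mean_ge0 ?(ltW X0)//.
by rewrite divfK// gt_eqF.
Qed.

(** After normalisation by X and Y, Young's inequality term by term does the work of Hölder's
    inequality, which is why the two embedding constants are added. *)
Lemma bilinear_embedding (r p q X Y : R) f g : 0 < r -> r < p -> r < q ->
  p^-1 + q^-1 = 1 -> 0 < X -> 0 < Y ->
  measurable_fun setT f -> measurable_fun setT g ->
  (\int[mu]_x (`|f x| `^ p)%:E <= (X `^ p)%:E)%E ->
  (\int[mu]_x (`|g x| `^ q)%:E <= (Y `^ q)%:E)%E ->
  \sum_(i <- s) fine (mu (E i)) * (power_mean r f (P i) * power_mean r g (P i)) <=
  (embedding_cst d (p / r) + embedding_cst d (q / r)) * (X * Y).
Proof.
move=> r0 rp rq pq X0 Y0 mf mg fX gY.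
have p0 : 0 < p by exact: lt_trans rp.
have q0 : 0 < q by exact: lt_trans rq.
have pi1 : p^-1 <= 1 by rewrite -pq lerDl invr_ge0 ltW.
have qi1 : q^-1 <= 1 by rewrite -pq lerDr invr_ge0 ltW.
have m0 i : 0 <= fine (mu (E i)) by exact: fine_ge0.
have XY : 0 < X * Y by rewrite mulr_gt0.
rewrite -ler_pdivrMr// mulr_suml.
apply: le_trans (lerD (power_mean_embedding r0 rp X0 mf fX)
  (power_mean_embedding r0 rq Y0 mg gY)).
rewrite -big_split/=; apply: ler_sum => i _; rewrite -mulrDr -mulrA ler_wpM2l//.
set x := power_mean r f (P i); set y := power_mean r g (P i).
have x0 : 0 <= x / X by rewrite divr_ge0 ?power_mean_ge0// ltW.
have y0 : 0 <= y / Y by rewrite divr_ge0 ?power_mean_ge0// ltW.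
rewrite invfM mulrACA (le_trans (conjugate_powR x0 y0 p0 q0 pq))//.
by rewrite lerD// ler_piMr ?powR_ge0.
Qed.

End family.
End power_means.

(** * From the BMO norm to integral bounds *)

Section bmo.
Context {R : realType} {d : nat}.
Local Notation mu := (lebesgue R d).

Lemma measurable_locally_integrable (b : euclid R d -> R) :
  (forall Q : cube R d, mu.-integrable (cube_set Q) (EFin \o b)) ->
  measurable_fun setT b.
Proof.
move=> ib; pose Q n : cube R d := ([tuple 0 | i < d], n%:R).
have -> : [set: euclid R d] = \bigcup_n cube_set (Q n).
  apply/esym/seteqP; split=> // x _.
  pose M := \sum_(i < d) `|tnth x i|.
  have xM i : `|tnth x i| <= M.
    by rewrite /M (bigD1 i)//= lerDl sumr_ge0.
  exists (Num.truncn (2 * M)).+1 => // i.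
  have := truncnS_gt (2 * M); rewrite /Q/cube_set/center/side/= tnth_mktuple => h.
  have := xM i; rewrite ler_norml => /andP[h1 h2]; apply/andP; split; lra.
apply/measurable_fun_bigcup => [n|n]; first exact: measurable_cube.
by have /integrableP[/measurable_EFinP] := ib (Q n).
Qed.

Lemma bmo_norm_ge0 (b : euclid R d -> R) : (0 <= bmo_norm b)%E.
Proof.
pose Q : cube R d := ([tuple 0 | i < d], 1).
apply: (@le_trans _ _ (average Q (fun x => `|b x - average Q b|))%:E).
  by rewrite lee_fin average_ge0//; exact: ltr01.
by apply: ereal_sup_ubound; exists Q => //=; exact: ltr01.
Qed.

Lemma bmo_boundedP (b : euclid R d -> R) (B : R) :
  (forall Q : cube R d, mu.-integrable (cube_set Q) (EFin \o b)) ->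
  (bmo_norm b <= B%:E)%E -> bmo_bounded b B.
Proof.
move=> ib bB; have mb := measurable_locally_integrable ib.
split=> // Q l0; have mQ := measurable_cube Q.
rewrite averageE//.
  rewrite lee_fin ler_pM2r ?vol_gt0// -lee_fin (le_trans _ bB)//.
  by apply: ereal_sup_ubound; exists Q.
(* Finiteness has to be checked: [average] goes through [fine], which would turn an infinite
   oscillation into 0. *)
have /integrableP[_ ibQ] := ib Q.
apply: (@le_lt_trans _ _ (\int[mu]_(x in cube_set Q)
   (`|(EFin \o b) x| + `|average Q b|%:E))%E).
  apply: ge0_le_integral => //.
  - apply/measurable_EFinP; apply: measurable_funTS; apply: measurableT_comp => //.
    by apply: measurable_funB => //; exact: measurable_cst.
  - apply: emeasurable_funD; last exact: measurable_cst.
    apply: measurableT_comp => //; apply/measurable_EFinP; exact: measurable_funTS.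
  - by move=> x _; rewrite -EFinD lee_fin ler_normB.
rewrite ge0_integralD//; last first.
  apply: measurableT_comp => //; apply/measurable_EFinP; exact: measurable_funTS.
rewrite (integral_cst mu mQ `|average Q b|%:E) lte_add_pinfty//.
by rewrite lte_mul_pinfty// lebesgue_cube_lty// ltW.
Qed.

End bmo.

(** * The sparse sum *)

Section domination_bound.
Context {R : realType} {d : nat}.
Local Notation mu := (lebesgue R d).
Local Notation func := (euclid R d -> R).

Lemma linear_onN (F : set func) (phi : func -> R) (u : func) :
  F 0 -> F u -> linear_on F phi -> phi (- u) = - phi u.
Proof.
move=> F0 Fu lphi; have phi0 : phi 0 = 0.
  by have := lphi 1 0 0 F0 F0; rewrite scaler0 addr0 mul1r; lra.
by have := lphi (-1) u 0 Fu F0; rewrite scaleN1r addr0 phi0 addr0 mulN1r.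
Qed.

Definition pairfun (u v : func) : 'I_2 -> func := fun i => if i == ord0 then u else v.

Lemma body_dot_le (Q : cube R d) (b f g : func) (alpha beta c p u v w : R) :
  0 < side Q ->
  (forall x, 0 <= b x) -> 0 <= alpha -> 0 <= beta -> alpha + beta <= 1 ->
  measurable_fun setT b -> measurable_fun setT f -> measurable_fun setT g ->
  let L1 := carrier (L1_normalized Q) in
  L1 (powmul b beta f) -> L1 (powmul b alpha f) ->
  L1 (powmul b beta g) -> L1 (powmul b alpha g) ->
  0 <= v -> 0 <= w ->
  (\int[mu]_(x in cube_set Q) (`|b x - c| `^ (alpha + beta) * `|f x|)%:E
     <= (p * vol Q)%:E)%E ->
  (\int[mu]_(x in cube_set Q) `|f x|%:E <= (u * vol Q)%:E)%E ->
  (\int[mu]_(x in cube_set Q) `|g x|%:E <= (v * vol Q)%:E)%E ->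
  (\int[mu]_(x in cube_set Q) (`|b x - c| `^ (alpha + beta) * `|g x|)%:E
     <= (w * vol Q)%:E)%E ->
  (body_dot
    (convex_body (L1_normalized Q) (pairfun (powmul b beta f) (powmul b alpha f)))
    (convex_body (L1_normalized Q) (pairfun (powmul b alpha g) (- powmul b beta g)%R))
   <= (p * v + u * w)%:E)%E.
Proof.
move=> l0 b0 a0 be0 ab1 mb mf mg L1 Lbf Laf Lbg Lag v0 w0 hp hu hv hw.
apply: ge_ereal_sup => _ [_ [phi phiB <-] [_ [psi psiB <-] <-]].
rewrite big_ord_recl big_ord1 !mxE /pairfun/= lee_fin.
rewrite (linear_onN (F := L1) _ _ psiB.1)//; last exact: L1_0.
rewrite mulrN.
exact: (pairing_le l0 b0 a0 be0 ab1 mb mf mg Lbf Laf Lbg Lag v0 w0 hp hu hv hw).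
Qed.

(** Sparseness turns each volume into the measure of a disjoint piece, and the product of the two
    L^r means over the dilated cube is then summed by [bilinear_embedding]. *)
Lemma sparse_sum_le (S : set (cube R d)) (gamma delta r p q B X Y alpha beta : R)
    (b f g : func) :
  (forall Q, S Q -> 0 < side Q) -> 1 <= gamma -> 0 < delta -> sparse delta S ->
  1 < r -> r < p -> r < q -> p^-1 + q^-1 = 1 ->
  0 < B -> bmo_bounded b B -> (forall x, 0 <= b x) ->
  0 <= alpha -> 0 <= beta -> alpha + beta <= 1 ->
  measurable_fun setT f -> measurable_fun setT g ->
  (forall Q, S Q -> let L1 := carrier (L1_normalized (dilate gamma Q)) in
    [/\ L1 (powmul b beta f), L1 (powmul b alpha f), L1 (powmul b beta g) &
        L1 (powmul b alpha g)]) ->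
  0 < X -> 0 < Y ->
  (\int[mu]_x (`|f x| `^ p)%:E <= (X `^ p)%:E)%E ->
  (\int[mu]_x (`|g x| `^ q)%:E <= (Y `^ q)%:E)%E ->
  (\esum_(Q in S) ((vol Q)%:E * body_dot
     (convex_body (L1_normalized (dilate gamma Q))
       (pairfun (powmul b beta f) (powmul b alpha f)))
     (convex_body (L1_normalized (dilate gamma Q))
       (pairfun (powmul b alpha g) (- powmul b beta g)%R))) <=
   (delta^-1 * (2 * local_cst d r ^+ 2) *
     (embedding_cst d (p / r) + embedding_cst d (q / r)) *
     (B `^ (alpha + beta) * (X * Y)))%:E)%E.
Proof.
move=> S0 g1 de0 [E [mE EQ tE Ede]] r1 rp rq pq B0 bB b0 a0 be0 ab1 mf mg L1S
  X0 Y0 fX gY.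
have mb : measurable_fun setT b by have [] := bB.
have s01 : 0 <= alpha + beta <= 1 by rewrite addr_ge0.
set s := alpha + beta in s01 *.
set K := local_cst d r; have K0 : 0 < K := @local_cst_gt0 R d r.
pose Q0 : cube R d := ([tuple 0 | i < d], 1).
(* Junk cubes off [S] keep all sides positive. *)
pose P Q := if `[< S Q >] then dilate gamma Q else Q0.
pose E' Q := if `[< S Q >] then E Q else set0.
have PS Q : S Q -> P Q = dilate gamma Q by move=> SQ; rewrite /P asboolT.
have ES Q : S Q -> E' Q = E Q by move=> SQ; rewrite /E' asboolT.
have P0 Q : 0 < side (P Q).
  rewrite /P; case: asboolP => [/S0 l0|_]; last exact: ltr01.
  by rewrite mulr_gt0//; lra.
have mE' Q : measurable (E' Q).
  by rewrite /E'; case: asboolP => // /mE.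
have EP Q : E' Q `<=` cube_set (P Q).
  rewrite /E' /P; case: asboolP => [SQ x /(EQ _ SQ)|_ x []].
  by apply: cube_set_dilate => //; exact: S0.
(* The infinite sum is a supremum over finite subfamilies, so finite families suffice. *)
apply: ge_ereal_sup => _ [A [finA AS] <-].
rewrite fsbig_finite//=.
have sS Q : Q \in fset_set A -> S Q by rewrite in_fset_set// => /set_mem/AS.
have tE' : trivIset [set` fset_set A] E'.
  move=> Q Q' /= /sS SQ /sS SQ'; rewrite !ES//; exact: tE.
pose m Q := fine (mu (E' Q)).
pose af Q := power_mean r f (P Q); pose ag Q := power_mean r g (P Q).
have r0 : 0 < r := lt_trans ltr01 r1.
have rp' : 0 < r <= p by rewrite r0 ltW.
have rq' : 0 < r <= q by rewrite r0 ltW.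
have fp := le_lt_trans fX (ltry _); have gq := le_lt_trans gY (ltry _).
(* The bound p * v + u * w of [body_dot_le] has two products, each with K^2 and one factor B^s. *)
pose k := delta^-1 * (2 * K ^+ 2) * B `^ s.
have Bs0 : 0 <= B `^ s by exact: powR_ge0.
have Kge0 := ltW K0; have dge0 := ltW de0.
have K2 : 0 <= 2 * K ^+ 2 * B `^ s by rewrite mulr_ge0// mulr_ge0// exprn_ge0.
have k0 : 0 <= k by rewrite /k mulr_ge0// mulr_ge0 ?invr_ge0// mulr_ge0// exprn_ge0.
apply: (@le_trans _ _ (\sum_(Q <- fset_set A) (k * (m Q * (af Q * ag Q)))%:E)%E).
  rewrite big_seq [leRHS]big_seq; apply: lee_sum => Q /sS SQ.
  have [Lbf Laf Lbg Lag] := L1S _ SQ; rewrite -!(PS _ SQ) in Lbf Laf Lbg Lag *.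
  have l0 := P0 Q.
  have af0 : 0 <= af Q := power_mean_ge0 r f (P Q).
  have ag0 : 0 <= ag Q := power_mean_ge0 r g (P Q).
  have hf : (\int[mu]_(x in cube_set (P Q)) (`|f x| `^ r)%:E <=
      (af Q `^ r * vol (P Q))%:E)%E.
    by rewrite (power_mean_integral rp' mf l0 fp); exact: lexx.
  have hg : (\int[mu]_(x in cube_set (P Q)) (`|g x| `^ r)%:E <=
      (ag Q `^ r * vol (P Q))%:E)%E.
    by rewrite (power_mean_integral rq' mg l0 gq); exact: lexx.
  (* With exponent 0, [local_power_bound] also bounds the plain L^1 averages by L^r means. *)
  have z01 : 0 <= (0 : R) <= 1 by rewrite lexx ler01.
  have hp := local_power_bound B0 bB r1 s01 mf l0 af0 hf.
  have hw := local_power_bound B0 bB r1 s01 mg l0 ag0 hg.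
  have := local_power_bound B0 bB r1 z01 mf l0 af0 hf.
  under eq_integral do rewrite powRr0 mul1r.
  rewrite powRr0 mulr1 => hu.
  have := local_power_bound B0 bB r1 z01 mg l0 ag0 hg.
  under eq_integral do rewrite powRr0 mul1r.
  rewrite powRr0 mulr1 => hv.
  have v0 : 0 <= K * ag Q by rewrite mulr_ge0.
  have w0 : 0 <= K * B `^ s * ag Q by rewrite mulr_ge0// mulr_ge0.
  have hb := body_dot_le l0 b0 a0 be0 ab1 mb mf mg Lbf Laf Lbg Lag v0 w0 hp hu hv hw.
  have vQ := vol_gt0 (S0 _ SQ).
  apply: (le_trans (lee_wpmul2l _ hb)); first by rewrite lee_fin ltW.
  rewrite -EFinM lee_fin.
  have vm : vol Q <= delta^-1 * m Q.
    rewrite mulrC ler_pdivlMr// mulrC -lee_fin /m -(measure_piece P0 mE' EP).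
    by rewrite ES//; exact: Ede.
  have := ler_wpM2r (mulr_ge0 K2 (mulr_ge0 af0 ag0)) vm.
  rewrite /k -/K; move: (af Q) (ag Q) (m Q) (vol Q) (delta^-1) (B `^ s) (K) => *; lra.
rewrite sumEFin -mulr_sumr lee_fin.
have emb := bilinear_embedding P0 mE' EP (fset_uniq _) tE' r0 rp rq pq X0 Y0
  mf mg fX gY.
apply: (le_trans (ler_wpM2l k0 emb)); rewrite /k; lra.
Qed.

End domination_bound.

(** * Lebesgue norms as real numbers *)

Section norms.
Context {R : realType} {d : nat}.
Local Notation mu := (lebesgue R d).

Lemma hoelder_conjugate_EFin (p : R) : 1 < p ->
  hoelder_conjugate p%:E = (p / (p - 1))%:E.
Proof.
move=> p1; rewrite /hoelder_conjugate/= eqe gt_eqF ?(lt_trans ltr01)//.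
by rewrite inver subr_eq0 gt_eqF// -EFinM.
Qed.

Lemma Lfun_measurable (p : \bar R) (f : euclid R d -> R) :
  f \in Lfun mu p -> measurable_fun setT f.
Proof. by move=> /sub_Lfun_mfun/set_mem. Qed.

Lemma Lnorm_finite (p : R) (f : euclid R d -> R) : 0 < p -> f \in Lfun mu p%:E ->
  exists2 x : R, 0 <= x & ('N[mu]_(p%:E)[EFin \o f] = x%:E)%E /\
    (\int[mu]_x (`|f x| `^ p)%:E = (x `^ p)%:E)%E.
Proof.
move=> p0 /sub_Lfun_finLfun/set_mem/= fp.
have N0 := Lnorm_ge0 mu p%:E (EFin \o f).
have Nfin : ('N[mu]_(p%:E)[EFin \o f])%E \is a fin_num by rewrite ge0_fin_numE.
exists (fine ('N[mu]_(p%:E)[EFin \o f])%E); first exact: fine_ge0.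
split; first by rewrite fineK.
rewrite -poweR_EFin fineK// poweR_Lnorm ?gt_eqF//.
Qed.

End norms.

Theorem corollary7p10 (R : realType) (d : nat) (D : set (cube R d)) (gamma : R)
    (F G : set (euclid R d -> R))
    (T : (euclid R d -> R) -> (euclid R d -> R) -> R) :
  (0 < d)%N -> dyadic_system D -> 1 <= gamma ->
  function_space F -> function_space G -> operator_to_dual F G T ->
  convex_body_domination D (fun Q => L1_normalized (dilate gamma Q))
    (fun Q => L1_normalized (dilate gamma Q)) F G T ->
  forall p : R, 1 < p -> exists C : R,
  forall (b : euclid R d -> R) (alpha beta : R),
    (forall x, 0 <= b x) -> BMO b ->
    0 <= alpha -> 0 <= beta -> alpha + beta <= 1 ->
  forall f g : euclid R d -> R,
    F f -> F (powmul b alpha f) -> F (powmul b beta f) ->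
    G g -> G (powmul b alpha g) -> G (powmul b beta g) ->
    f \in Lfun (lebesgue R d) p%:E ->
    g \in Lfun (lebesgue R d) (hoelder_conjugate p%:E) ->
  (`|T (powmul b beta f) (powmul b alpha g)
     - T (powmul b alpha f) (powmul b beta g)|%:E
   <= C%:E * poweR (bmo_norm b) (alpha + beta)
      * 'N[lebesgue R d]_(p%:E)[EFin \o f]
      * 'N[lebesgue R d]_(hoelder_conjugate p%:E)[EFin \o g])%E.
Proof.
move=> _ [Dgen _ _] gamma1 _ [Gsub _] [linG _] [FGL1 dom] p p1.
rewrite (hoelder_conjugate_EFin p1); set q := p / (p - 1).
have q1 : 1 < q by rewrite ltr_pdivlMr; lra.
have pq : p^-1 + q^-1 = 1.
  by rewrite invf_div mulrBl mul1r divff ?subrKC//; lra.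
have [C0 [delta [C00 delta0 dom2]]] := dom 2.
pose r := (1 + Num.min p q) / 2.
have minp : Num.min p q <= p by rewrite ge_min lexx.
have minq : Num.min p q <= q by rewrite ge_min lexx orbT.
have min1 : 1 < Num.min p q by rewrite lt_min p1.
have [r1 rp rq] : [/\ 1 < r, r < p & r < q] by rewrite /r; split; lra.
pose C1 := delta^-1 * (2 * local_cst d r ^+ 2) *
  (embedding_cst d (p / r) + embedding_cst d (q / r)).
exists (C0 * C1) => b alpha beta b0 [ib bfin] a0 be0 ab1 f g Ff Faf Fbf Gg Gag Gbg.
move=> fp gq; have mf := Lfun_measurable fp; have mg := Lfun_measurable gq.
have p0 : 0 < p := lt_trans ltr01 p1.
have q0 : 0 < q := lt_trans ltr01 q1.
have [x x0 [-> fX]] := Lnorm_finite p0 fp.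
have [y y0 [-> gY]] := Lnorm_finite q0 gq.
have bmo0 := bmo_norm_ge0 b.
have bmofin : bmo_norm b \is a fin_num by rewrite ge0_fin_numE.
rewrite -(fineK bmofin); set B0 := fine _.
have B00 : 0 <= B0 by exact: fine_ge0.
rewrite poweR_EFin -!EFinM lee_fin.
set s := alpha + beta; set z := `| _ |.
have s0 : 0 <= s by rewrite addr_ge0.
have Dside Q : D Q -> 0 < side Q.
  by move=> /Dgen[k [_ ->]]; rewrite exprz_gt0.
have G0 : G 0 by have [/set_mem] := Gsub.
have GN u : G u -> G (- u).
  have [_ lin] := Gsub => Gu.
  by have := lin (-1) u 0 (mem_set Gu) (mem_set G0); rewrite scaleN1r addr0 => /set_mem.
(* The estimate with positive majorants of the three norms; any of the norms themselves may be 0. *)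
have key B X Y : 0 < B -> B0 <= B -> 0 < X -> x <= X -> 0 < Y -> y <= Y ->
    z <= C0 * C1 * B `^ s * X * Y.
  move=> Bp BB Xp xX Yp yY.
  have bB : bmo_bounded b B.
    by apply: bmo_boundedP => //; rewrite -(fineK bmofin) lee_fin.
  have Fpair i : F (pairfun (powmul b beta f) (powmul b alpha f) i).
    by rewrite /pairfun; case: ifP.
  have Gpair i : G (pairfun (powmul b alpha g) (- powmul b beta g)%R i).
    by rewrite /pairfun; case: ifP => // _; exact: GN.
  have [S [SD spS zS]] := dom2 _ _ Fpair Gpair.
  have fXX : (\int[lebesgue R d]_x (`|f x| `^ p)%:E <= (X `^ p)%:E)%E.
    by rewrite fX lee_fin ge0_ler_powR ?nnegrE// ltW.
  have gYY : (\int[lebesgue R d]_x (`|g x| `^ q)%:E <= (Y `^ q)%:E)%E.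
    by rewrite gY lee_fin ge0_ler_powR ?nnegrE// ltW.
  have L1S Q : S Q -> let L1 := carrier (L1_normalized (dilate gamma Q)) in
    [/\ L1 (powmul b beta f), L1 (powmul b alpha f), L1 (powmul b beta g) &
        L1 (powmul b alpha g)].
    by move=> /SD/FGL1[FL GL]; split; [exact: FL|exact: FL|exact: GL|exact: GL].
  have Sside Q : S Q -> 0 < side Q by move=> /SD/Dside.
  have := sparse_sum_le Sside gamma1 delta0 spS r1 rp rq pq Bp bB b0 a0 be0 ab1 mf
    mg L1S Xp Yp fXX gYY.
  rewrite -/C1 -/s => sle.
  have zE : z = `|\sum_(i < 2) T (pairfun (powmul b beta f) (powmul b alpha f) i)
      (pairfun (powmul b alpha g) (- powmul b beta g)%R i)|.
    rewrite big_ord_recl big_ord1 /pairfun/=.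
    by rewrite (linear_onN (F := G) G0 Gbg)//; exact: linG.
  rewrite -zE in zS; rewrite -lee_fin (le_trans zS)//.
  apply: (@le_trans _ _ (C0%:E * (C1 * (B `^ s * (X * Y)))%:E)%E).
    by apply: lee_wpmul2l => //; rewrite lee_fin ltW.
  by rewrite -EFinM lee_fin !mulrA.
have key1 X Y : 0 < X -> x <= X -> 0 < Y -> y <= Y -> z <= C0 * C1 * B0 `^ s * X * Y.
  move=> Xp xX Yp yY.
  (* For s = 0 the factor is 1 even when [B0] vanishes, so any positive majorant will do. *)
  have [s00|sn0] := eqVneq s 0.
    have Bp : 0 < B0 + 1 by exact: ltr_wpDl.
    have := key (B0 + 1) X Y Bp _ Xp xX Yp yY.
    by rewrite s00 !powRr0 lerDl ler01; exact.
  have sp : 0 < s by rewrite lt0r sn0.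
  rewrite (mulrAC _ _ X) (mulrAC _ _ Y).
  (* The closure lemma is linear in its variable, so the limit is taken in t = B^s, that is B =
     t^(1/s). *)
  apply: le_mul_closure => [|t tp Bt]; first exact: powR_ge0.
  have tE : (t `^ s^-1) `^ s = t by rewrite -powRrM mulVf// powRr1// ltW.
  have tB : B0 <= t `^ s^-1.
    have -> : B0 = (B0 `^ s) `^ s^-1 by rewrite -powRrM divff// powRr1.
    by rewrite ge0_ler_powR ?nnegrE ?invr_ge0 ?powR_ge0// ltW.
  have := key (t `^ s^-1) X Y (powR_gt0 _ tp) tB Xp xX Yp yY.
  by rewrite tE (mulrAC _ t) (mulrAC _ t).
apply: le_mul_closure => // Y Yp yY.
rewrite (mulrAC _ x); apply: le_mul_closure => // X Xp xX.
by rewrite (mulrAC _ Y); exact: key1.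
Qed.
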